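(* For any $\lambda\in\mathbb R$, the 3D steady Stokes operator $\mathfrak L_0$ is a golden transmutation of $\Delta^{\otimes4}$ by the philosopher's stone $$\big(P,\;\tfrac13R^*+\lambda\hat Q,\;R,\;\tfrac13P^*+\lambda\hat S,\;T+\lambda\hat T\big),$$ where the differential operators $P,R,T,\hat Q,\hat S,\hat T$ are those defined in the context and $^*$ denotes the formal adjoint.
   Context: All functions are on $\mathbb R^3$ with variable $x$; $\wedge$ is the vector product of $\mathbb R^3$. For $(u,p)\in C^\infty(\mathbb R^3;\mathbb R^3\times\mathbb R)$, $\mathfrak L_0(u,p)=(\Delta u-\nabla p,\ \operatorname{div}u)$. The operator $\Delta^{\otimes4}$ acts on $C^\infty(\mathbb R^3;\mathbb R^4)=C^\infty(\mathbb R^3;\mathbb R^3\times\mathbb R)$ by the Laplacian componentwise. For $(v,w)\in C^\infty(\mathbb R^3;\mathbb R^3\times\mathbb R)$: $$P(v,w):=\Big(\tfrac32v-\tfrac12x\operatorname{div}v-\tfrac12x\wedge(\operatorname{curl}v-\nabla w),\ -2\operatorname{div}v\Big),$$ $$R(v,w):=\Big(\tfrac52v-\tfrac12x\operatorname{div}v-\tfrac12x\wedge(\operatorname{curl}v-\nabla w),\ -\tfrac12x\cdot v\Big).$$ For $(u,p)\in C^\infty(\mathbb R^3;\mathbb R^3\times\mathbb R)$: $$T(u,p):=\Big(\tfrac13px+\tfrac1{12}|x|^2u,\ \tfrac73p+\tfrac13x\cdot u\Big),$$ $$\hat Q(u,p):=(x\operatorname{div}u,\,0),\quad \hat S(u,p):=(x\Delta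 p+2\nabla p,\,0),\quad \hat T(u,p):=\Big(\tfrac12|x|^2\nabla p,\ 6p+2x\cdot\nabla p\Big).$$ The formal adjoint $A^*$ of a linear differential operator $A$ with smooth matrix-valued coefficients is characterized by $\langle Au,v\rangle_{L^2}=\langle u,A^*v\rangle_{L^2}$ for all compactly supported smooth $u,v$. For linear mappings $A:\mathcal E\to\mathcal F$, $B:\mathcal G\to\mathcal H$, $A$ is a golden transmutation of $B$ by $(P,Q,R,S,T)$, where $P:\mathcal G\to\mathcal E$, $Q:\mathcal E\to\mathcal G$, $R:\mathcal H\to\mathcal F$, $S:\mathcal F\to\mathcal H$, $T:\mathcal F\to\mathcal E$ are linear, if $AP=RB$, $BQ=SA$, $PQ+TA=\mathrm{Id}_{\mathcal E}$ and $RS+AT=\mathrm{Id}_{\mathcal F}$. Here all four spaces are $C^\infty(\mathbb R^3;\mathbb R^3\times\mathbb R)$. *)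

(* Defs.v *)
From HB Require Import structures.
From mathcomp Require Import all_boot all_order all_algebra.
From mathcomp Require Import all_classical all_reals all_analysis.
From mathcomp Require Import ring.

Set Implicit Arguments.
Unset Strict Implicit.
Unset Printing Implicit Defensive.

Import Order.TTheory GRing.Theory Num.Theory.
Import numFieldNormedType.Exports.

Local Open Scope classical_set_scope.
Local Open Scope ring_scope.

Definition golden_transmutation (K : pzRingType) (E F G H : lmodType K)
    (A : {linear E -> F}) (B : {linear G -> H})
    (P : {linear G -> E}) (Q : {linear E -> G}) (R : {linear H -> F})
    (S : {linear F -> H}) (T : {linear F -> E}) : Prop :=
  [/\ A \o P =1 R \o B,
      B \o Q =1 S \o A,
      (P \o Q) \+ (T \o A) =1 id
    & (R \o S) \+ (A \o T) =1 id].

Section scalar_calculus.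
Context {R : realType}.
Local Notation X := 'rV[R]_3.
Implicit Types (f g : X -> R) (i : 'I_3) (k n : nat).

Definition partial i f : X -> R := fun x => 'D_('e_i) f x.

Fixpoint Ck k f : Prop :=
  if k is k'.+1 then
    [/\ continuous f,
        forall i x, derivable f x 'e_i
      & forall i, Ck k' (partial i f)]
  else continuous f.

Definition smooth f : Prop := forall k, Ck k f.

Definition laplacian f : X -> R := fun x => \sum_i partial i (partial i f) x.

(* The multi-index derivative d_0^(a 0) d_1^(a 1) d_2^(a 2) f. *)
Definition mpartial n (a : {ffun 'I_3 -> 'I_n}) f : X -> R :=
  foldr (fun i => iter (a i) (partial i)) f (enum 'I_3).

Lemma Ck_continuous k f : Ck k f -> continuous f.
Proof. by case: k => [|k] //= []. Qed.

Lemma CkW k f : Ck k.+1 f -> Ck k f.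
Proof.
elim: k f => [|k IH] f; first by case.
by move=> [cf df pf]; split => // i; exact/IH/pf.
Qed.

Lemma Ck_cst k (c : R) : Ck k (fun=> c).
Proof.
elim: k c => [|k IH] c; first exact: cst_continuous.
split; [exact: cst_continuous|by move=> i x; exact: derivable_cst|move=> i].
have -> : partial i (fun=> c) = fun=> 0.
  by apply/funext => x; rewrite /partial derive_cst.
exact: IH.
Qed.

Lemma CkD k f g : Ck k f -> Ck k g -> Ck k (fun x => f x + g x).
Proof.
elim: k f g => [|k IH] f g.
  by move=> cf cg x; apply: (@continuousD _ R^o); [exact: cf|exact: cg].
move=> [cf df pf] [cg dg pg]; split.
- by move=> x; apply: (@continuousD _ R^o); [exact: cf|exact: cg].
- by move=> i x; exact: derivableD.
- move=> i; have -> : partial i (fun x => f x + g x) =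
    fun x => partial i f x + partial i g x.
    by apply/funext => x; rewrite /partial deriveD.
  by apply: IH; [exact: pf|exact: pg].
Qed.

Lemma CkM k f g : Ck k f -> Ck k g -> Ck k (fun x => f x * g x).
Proof.
elim: k f g => [|k IH] f g.
  by move=> cf cg x; apply: continuousM; [exact: cf|exact: cg].
move=> Hf Hg; have [kf kg] := (CkW Hf, CkW Hg).
case: Hf Hg => [cf df pf] [cg dg pg]; split.
- by move=> x; apply: continuousM; [exact: cf|exact: cg].
- by move=> i x; exact: derivableM.
- move=> i; have -> : partial i (fun x => f x * g x) =
    fun x => f x * partial i g x + g x * partial i f x.
    by apply/funext => x; rewrite /partial deriveM.
  by apply: CkD; apply: IH => //; [exact: pg|exact: pf].
Qed.

Lemma derivable_coord j x v : derivable (fun y : X => y 0 j : R) x v.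
Proof. by have /derivable_mxP := @derivable_id R X x v; exact. Qed.

Lemma partial_coord i j :
  partial i (fun y : X => y 0 j : R) = fun=> (i == j)%:R.
Proof.
apply/funext => x; rewrite /partial.
have := @derive_id R X x 'e_i.
rewrite derive_mx; last exact: derivable_id.
by move/(congr1 (fun M : X => M 0 j)); rewrite !mxE eqxx /= eq_sym => ->.
Qed.

Lemma smooth_coord j : smooth (fun y : X => y 0 j : R).
Proof.
case => [|k]; first by move=> x; exact: coord_continuous.
split; [by move=> x; exact: coord_continuous
       |by move=> i x; exact: derivable_coord|move=> i].
by rewrite partial_coord; exact: Ck_cst.
Qed.

Lemma smooth_cst (c : R) : smooth (fun=> c).
Proof. by move=> k; exact: Ck_cst. Qed.

Lemma smoothD f g : smooth f -> smooth g -> smooth (fun x => f x + g x).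
Proof. by move=> sf sg k; apply: CkD; [exact: sf|exact: sg]. Qed.

Lemma smoothM f g : smooth f -> smooth g -> smooth (fun x => f x * g x).
Proof. by move=> sf sg k; apply: CkM; [exact: sf|exact: sg]. Qed.

Lemma smoothN f : smooth f -> smooth (fun x => - f x).
Proof.
move=> sf; rewrite (_ : (fun x => _) = fun x => -1 * f x).
  exact: smoothM (smooth_cst (-1)) sf.
by apply/funext => x; rewrite mulN1r.
Qed.

Lemma smooth_partial i f : smooth f -> smooth (partial i f).
Proof. by move=> sf k; case: (sf k.+1) => _ _; exact. Qed.

Lemma smooth_sum n (h : 'I_n -> X -> R) :
  (forall l, smooth (h l)) -> smooth (fun x => \sum_l h l x).
Proof.
elim: n h => [|n IH] h sh.
  rewrite (_ : (fun x => _) = fun=> 0); first exact: smooth_cst.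
  by apply/funext => x; rewrite big_ord0.
rewrite (_ : (fun x => _) =
  fun x => h ord0 x + \sum_(l < n) h (lift ord0 l) x).
  by apply: smoothD; [exact: sh|apply: IH => l; exact: sh].
by apply/funext => x; rewrite big_ord_recl.
Qed.

Lemma smooth_laplacian f : smooth f -> smooth (laplacian f).
Proof. by move=> sf; apply: smooth_sum => i; do 2!apply: smooth_partial. Qed.

Lemma smooth_derivable f i x : smooth f -> derivable f x 'e_i.
Proof. by move=> /(_ 1%N)[_ + _]; exact. Qed.

Lemma partial_lin i (a : R) f g : smooth f -> smooth g ->
  partial i (fun x => a * f x + g x) =
  fun x => a * partial i f x + partial i g x.
Proof.
move=> sf sg; apply/funext => x; rewrite /partial.
have df := @smooth_derivable f i x sf.
have dg := @smooth_derivable g i x sg.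
have := @deriveD R X R^o (a *: (f : X -> R^o)) g x 'e_i
  (@derivableZ R X R^o f a x _ df) dg.
by rewrite (@deriveZ R X R^o f a x _ df).
Qed.

Lemma laplacian_lin (a : R) f g : smooth f -> smooth g ->
  laplacian (fun x => a * f x + g x) =
  fun x => a * laplacian f x + laplacian g x.
Proof.
move=> sf sg; apply/funext => x; rewrite /laplacian mulr_sumr -big_split /=.
apply: eq_bigr => i _; rewrite partial_lin // partial_lin //;
  exact: smooth_partial.
Qed.

End scalar_calculus.

Section vector_calculus.
Context {R : realType}.
Local Notation X := 'rV[R]_3.

Definition entry m n (i : 'I_m) (j : 'I_n) (F : X -> 'M[R]_(m, n)) : X -> R :=
  fun x => F x i j.

Definition smooth_mx m n (F : X -> 'M[R]_(m, n)) : Prop :=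
  forall i j, smooth (entry i j F).

Definition dot n (a b : 'rV[R]_n) : R := \sum_i a 0 i * b 0 i.

(* Indices are added modulo 3, as elements of the additive group 'I_3. *)
Definition cross (a b : X) : X :=
  \row_i (a 0 (i + 1) * b 0 (i + 2) - a 0 (i + 2) * b 0 (i + 1)).

Definition grad (f : X -> R) : X -> X := fun x => \row_i partial i f x.

Definition div (v : X -> X) : X -> R :=
  fun x => \sum_i partial i (entry 0 i v) x.

Definition curl (v : X -> X) : X -> X := fun x =>
  \row_i (partial (i + 1) (entry 0 (i + 2) v) x
          - partial (i + 2) (entry 0 (i + 1) v) x).

Definition laplacian_mx m n (F : X -> 'M[R]_(m, n)) : X -> 'M[R]_(m, n) :=
  fun x => \matrix_(i, j) laplacian (entry i j F) x.

Lemma smooth_mx_id : smooth_mx (id : X -> X).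
Proof. by move=> i j; rewrite (ord1 i); exact: smooth_coord. Qed.

Lemma smooth_mxD m n (F G : X -> 'M[R]_(m, n)) :
  smooth_mx F -> smooth_mx G -> smooth_mx (fun x => F x + G x).
Proof.
move=> sF sG i j; rewrite (_ : entry i j _ =
  fun x => entry i j F x + entry i j G x); first exact: smoothD.
by apply/funext => x; rewrite /entry mxE.
Qed.

Lemma smooth_mxZ m n (f : X -> R) (F : X -> 'M[R]_(m, n)) :
  smooth f -> smooth_mx F -> smooth_mx (fun x => f x *: F x).
Proof.
move=> sf sF i j; rewrite (_ : entry i j _ =
  fun x => f x * entry i j F x); first exact: smoothM.
by apply/funext => x; rewrite /entry mxE.
Qed.

Lemma smooth_mxN m n (F : X -> 'M[R]_(m, n)) :
  smooth_mx F -> smooth_mx (fun x => - F x).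
Proof.
move=> sF i j; rewrite (_ : entry i j _ =
  fun x => - entry i j F x); first exact: smoothN.
by apply/funext => x; rewrite /entry mxE.
Qed.

Lemma smooth_mx0 m n : smooth_mx (fun=> 0 : 'M[R]_(m, n)).
Proof.
move=> i j; rewrite (_ : entry i j _ = fun=> 0); first exact: smooth_cst.
by apply/funext => x; rewrite /entry mxE.
Qed.

Lemma smooth_dot n (F G : X -> 'rV[R]_n) :
  smooth_mx F -> smooth_mx G -> smooth (fun x => dot (F x) (G x)).
Proof.
by move=> sF sG; apply: smooth_sum => i; apply: smoothM; [exact: sF|exact: sG].
Qed.

Lemma smooth_cross (F G : X -> X) :
  smooth_mx F -> smooth_mx G -> smooth_mx (fun x => cross (F x) (G x)).
Proof.
move=> sF sG i j; rewrite (_ : entry i j _ = fun x =>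
    entry 0 (j + 1) F x * entry 0 (j + 2) G x
    + - (entry 0 (j + 2) F x * entry 0 (j + 1) G x)).
  by apply: smoothD; [|apply: smoothN]; apply: smoothM.
by apply/funext => x; rewrite /entry mxE.
Qed.

Lemma smooth_grad f : smooth f -> smooth_mx (grad f).
Proof.
move=> sf i j; rewrite (_ : entry i j _ = partial j f).
  exact: smooth_partial.
by apply/funext => x; rewrite /entry mxE.
Qed.

Lemma smooth_div v : smooth_mx v -> smooth (div v).
Proof. by move=> sv; apply: smooth_sum => i; exact: smooth_partial. Qed.

Lemma smooth_curl v : smooth_mx v -> smooth_mx (curl v).
Proof.
move=> sv i j; rewrite (_ : entry i j _ = fun x =>
    partial (j + 1) (entry 0 (j + 2) v) x
    + - partial (j + 2) (entry 0 (j + 1) v) x).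
  by apply: smoothD; [|apply: smoothN]; exact: smooth_partial.
by apply/funext => x; rewrite /entry mxE.
Qed.

Lemma smooth_laplacian_mx m n (F : X -> 'M[R]_(m, n)) :
  smooth_mx F -> smooth_mx (laplacian_mx F).
Proof.
move=> sF i j; rewrite (_ : entry i j _ = laplacian (entry i j F)).
  exact: smooth_laplacian.
by apply/funext => x; rewrite /entry mxE.
Qed.

Lemma entry_lin m n i j (a : R) (F G : X -> 'M[R]_(m, n)) :
  entry i j (fun x => a *: F x + G x) =
  fun x => a * entry i j F x + entry i j G x.
Proof. by apply/funext => x; rewrite /entry !mxE. Qed.

Lemma grad_lin (a : R) f g : smooth f -> smooth g ->
  grad (fun x => a * f x + g x) = fun x => a *: grad f x + grad g x.
Proof.
move=> sf sg; apply/funext => x; apply/rowP => i.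
by rewrite !mxE partial_lin.
Qed.

Lemma div_lin (a : R) v w : smooth_mx v -> smooth_mx w ->
  div (fun x => a *: v x + w x) = fun x => a * div v x + div w x.
Proof.
move=> sv sw; apply/funext => x; rewrite /div mulr_sumr -big_split /=.
by apply: eq_bigr => i _; rewrite entry_lin partial_lin.
Qed.

Lemma curl_lin (a : R) v w : smooth_mx v -> smooth_mx w ->
  curl (fun x => a *: v x + w x) = fun x => a *: curl v x + curl w x.
Proof.
move=> sv sw; apply/funext => x; apply/rowP => i.
by rewrite !mxE !entry_lin !partial_lin //; ring.
Qed.

Lemma laplacian_mx_lin m n (a : R) (F G : X -> 'M[R]_(m, n)) :
  smooth_mx F -> smooth_mx G ->
  laplacian_mx (fun x => a *: F x + G x) =
  fun x => a *: laplacian_mx F x + laplacian_mx G x.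
Proof.
move=> sF sG; apply/funext => x; apply/matrixP => i j.
rewrite !mxE entry_lin.
by rewrite (laplacian_lin a (sF i j) (sG i j)).
Qed.

Lemma dot_linr n (a : R) (x y z : 'rV[R]_n) :
  dot x (a *: y + z) = a * dot x y + dot x z.
Proof.
rewrite /dot mulr_sumr -big_split; apply: eq_bigr => i _.
by rewrite !mxE /=; ring.
Qed.

Lemma cross_linr (a : R) (x y z : X) :
  cross x (a *: y + z) = a *: cross x y + cross x z.
Proof. by apply/rowP => i; rewrite !mxE; ring. Qed.

End vector_calculus.

Section smooth_functions.
Variable R : realType.
Local Notation X := 'rV[R]_3.
(* R^4 = R^3 x R: the first three columns are the vector part. *)
Local Notation R4 := 'rV[R]_(3 + 1).

Definition Cinf_pred : {pred X -> R4} :=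
  fun F => `[< smooth_mx F >].

Lemma Cinf_submod_closed : submod_closed Cinf_pred.
Proof.
split; first by apply/asboolP; exact: smooth_mx0.
move=> a F G /asboolP sF /asboolP sG; apply/asboolP.
apply: (@smooth_mxD _ _ _ (fun x => a *: F x) G) => //.
by apply: (@smooth_mxZ _ _ _ (fun=> a)) => //; exact: smooth_cst.
Qed.

HB.instance Definition _ := GRing.isSubmodClosed.Build R (X -> R4)
  Cinf_pred Cinf_submod_closed.

Record Cinf := MkCinf {
  Cinf_fun :> X -> R4;
  Cinf_smooth : Cinf_fun \in Cinf_pred }.

HB.instance Definition _ := [isSub for Cinf_fun].
HB.instance Definition _ := [Choice of Cinf by <:].
HB.instance Definition _ := [SubChoice_isSubLmodule of Cinf by <:].

Definition vpart (F : X -> R4) : X -> X := fun x => lsubmx (F x).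

Definition spart (F : X -> R4) : X -> R := fun x => rsubmx (F x) 0 0.

Definition join (v : X -> X) (w : X -> R) : X -> R4 :=
  fun x => row_mx (v x) (w x)%:M.

Lemma smooth_vpart F : smooth_mx F -> smooth_mx (vpart F).
Proof.
move=> sF i j; rewrite (_ : entry i j _ = entry i (lshift 1 j) F) //.
by apply/funext => x; rewrite /entry mxE.
Qed.

Lemma smooth_spart F : smooth_mx F -> smooth (spart F).
Proof.
move=> sF; rewrite (_ : spart F = entry 0 (rshift 3 0) F) //.
by apply/funext => x; rewrite /entry /spart mxE.
Qed.

Lemma smooth_join v w : smooth_mx v -> smooth w -> smooth_mx (join v w).
Proof.
move=> sv sw i j; rewrite (ord1 i); case: (split_ordP j) => l ->.
  rewrite (_ : entry _ _ _ = entry 0 l v) //.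
  by apply/funext => x; rewrite /entry row_mxEl.
rewrite (_ : entry _ _ _ = w) //.
by apply/funext => x; rewrite /entry row_mxEr (ord1 l) mxE eqxx mulr1n.
Qed.

Lemma vpart_lin (a : R) F G :
  vpart (fun x => a *: F x + G x) = fun x => a *: vpart F x + vpart G x.
Proof. by apply/funext => x; rewrite /vpart linearP. Qed.

Lemma spart_lin (a : R) F G :
  spart (fun x => a *: F x + G x) = fun x => a * spart F x + spart G x.
Proof. by apply/funext => x; rewrite /spart !mxE. Qed.

Lemma join_lin (a : R) v v1 v2 w w1 w2 :
  (forall x, v x = a *: v1 x + v2 x) -> (forall x, w x = a * w1 x + w2 x) ->
  join v w = fun x => a *: join v1 w1 x + join v2 w2 x.
Proof.
move=> hv hw; apply/funext => x.
by rewrite /join hv hw scale_row_mx add_row_mx raddfD /= scale_scalar_mx.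
Qed.

Section lift.
Variable op : (X -> R4) -> X -> R4.
Hypothesis op_smooth : forall F, smooth_mx F -> smooth_mx (op F).
Hypothesis op_lin : forall (a : R) F G, smooth_mx F -> smooth_mx G ->
  op (fun x => a *: F x + G x) = fun x => a *: op F x + op G x.

Definition lift_fun (F : Cinf) : Cinf :=
  MkCinf (asboolT (op_smooth (asboolW (Cinf_smooth F)))).

Lemma lift_fun_linear : linear lift_fun.
Proof.
move=> a F G; apply: val_inj => /=.
by apply: op_lin; exact/asboolP/Cinf_smooth.
Qed.

HB.instance Definition _ :=
  GRing.isLinear.Build R Cinf Cinf *:%R lift_fun lift_fun_linear.

Definition lift : {linear Cinf -> Cinf} := lift_fun.

End lift.

Definition stokes_def F : X -> R4 := let u := vpart F in let p := spart F in
  join (fun x => laplacian_mx u x - grad p x) (div u).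

Definition P_def F : X -> R4 := let v := vpart F in let w := spart F in
  join (fun x => (3 / 2) *: v x - (1 / 2 * div v x) *: x
                 - (1 / 2) *: cross x (curl v x - grad w x))
       (fun x => - 2 * div v x).

Definition R_def F : X -> R4 := let v := vpart F in let w := spart F in
  join (fun x => (5 / 2) *: v x - (1 / 2 * div v x) *: x
                 - (1 / 2) *: cross x (curl v x - grad w x))
       (fun x => - (1 / 2) * dot x (v x)).

Definition T_def F : X -> R4 := let u := vpart F in let p := spart F in
  join (fun x => (1 / 3 * p x) *: x + (1 / 12 * dot x x) *: u x)
       (fun x => 7 / 3 * p x + 1 / 3 * dot x (u x)).

Definition Qhat_def F : X -> R4 :=
  join (fun x => div (vpart F) x *: x) (fun=> 0).

Definition Shat_def F : X -> R4 := let p := spart F in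
  join (fun x => laplacian p x *: x + 2 *: grad p x) (fun=> 0).

Definition That_def F : X -> R4 := let p := spart F in
  join (fun x => (1 / 2 * dot x x) *: grad p x)
       (fun x => 6 * p x + 2 * dot x (grad p x)).

Ltac smooth_tac sF := have ? := smooth_vpart sF; have ? := smooth_spart sF;
  repeat first
    [ assumption | exact: smooth_mx_id | exact: smooth_cst
    | apply: smooth_join | apply: smooth_mxD | apply: smooth_mxN
    | apply: smooth_mxZ | apply: smooth_cross | apply: smooth_curl
    | apply: smooth_grad | apply: smooth_div | apply: smooth_laplacian_mx
    | apply: smooth_dot | apply: smoothD
    | apply: smoothM ].

Lemma stokes_smooth F : smooth_mx F -> smooth_mx (stokes_def F).
Proof. by move=> sF; smooth_tac sF. Qed.
Lemma P_smooth F : smooth_mx F -> smooth_mx (P_def F).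
Proof. by move=> sF; smooth_tac sF. Qed.
Lemma R_smooth F : smooth_mx F -> smooth_mx (R_def F).
Proof. by move=> sF; smooth_tac sF. Qed.
Lemma T_smooth F : smooth_mx F -> smooth_mx (T_def F).
Proof. by move=> sF; smooth_tac sF. Qed.
Lemma Qhat_smooth F : smooth_mx F -> smooth_mx (Qhat_def F).
Proof. by move=> sF; smooth_tac sF. Qed.
Lemma Shat_smooth F : smooth_mx F -> smooth_mx (Shat_def F).
Proof.
move=> sF; have sp := smooth_spart sF.
apply: smooth_join; last exact: smooth_cst.
apply: smooth_mxD.
  exact: smooth_mxZ (smooth_laplacian sp) smooth_mx_id.
exact: smooth_mxZ (smooth_cst 2) (smooth_grad sp).
Qed.
Lemma That_smooth F : smooth_mx F -> smooth_mx (That_def F).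
Proof. by move=> sF; smooth_tac sF. Qed.

Ltac lin_tac F G sF sG :=
  have ? := smooth_vpart sF; have ? := smooth_spart sF;
  have ? := smooth_vpart sG; have ? := smooth_spart sG;
  rewrite ?vpart_lin ?spart_lin;
  rewrite ?div_lin ?grad_lin ?curl_lin ?laplacian_lin ?laplacian_mx_lin //;
  let x := fresh "x" in apply: join_lin; intro x; rewrite ?dot_linr;
  generalize (dot x x) (dot x (vpart F x)) (dot x (vpart G x))
    (dot x (grad (spart F) x)) (dot x (grad (spart G) x))
    (div (vpart F) x) (div (vpart G) x) (curl (vpart F) x) (curl (vpart G) x)
    (grad (spart F) x) (grad (spart G) x)
    (laplacian (spart F) x) (laplacian (spart G) x)
    (laplacian_mx (vpart F) x) (laplacian_mx (vpart G) x)
    (vpart F x) (vpart G x) (spart F x) (spart G x) => *;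
  [apply/rowP => ?; rewrite !mxE|]; ring.

Lemma stokes_lin (a : R) F G : smooth_mx F -> smooth_mx G ->
  stokes_def (fun x => a *: F x + G x) =
  fun x => a *: stokes_def F x + stokes_def G x.
Proof. by move=> sF sG; rewrite /stokes_def; lin_tac F G sF sG. Qed.
Lemma P_lin (a : R) F G : smooth_mx F -> smooth_mx G ->
  P_def (fun x => a *: F x + G x) = fun x => a *: P_def F x + P_def G x.
Proof. by move=> sF sG; rewrite /P_def; lin_tac F G sF sG. Qed.
Lemma R_lin (a : R) F G : smooth_mx F -> smooth_mx G ->
  R_def (fun x => a *: F x + G x) = fun x => a *: R_def F x + R_def G x.
Proof. by move=> sF sG; rewrite /R_def; lin_tac F G sF sG. Qed.
Lemma T_lin (a : R) F G : smooth_mx F -> smooth_mx G ->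
  T_def (fun x => a *: F x + G x) = fun x => a *: T_def F x + T_def G x.
Proof. by move=> sF sG; rewrite /T_def; lin_tac F G sF sG. Qed.
Lemma Qhat_lin (a : R) F G : smooth_mx F -> smooth_mx G ->
  Qhat_def (fun x => a *: F x + G x) =
  fun x => a *: Qhat_def F x + Qhat_def G x.
Proof. by move=> sF sG; rewrite /Qhat_def; lin_tac F G sF sG. Qed.
Lemma Shat_lin (a : R) F G : smooth_mx F -> smooth_mx G ->
  Shat_def (fun x => a *: F x + G x) =
  fun x => a *: Shat_def F x + Shat_def G x.
Proof. by move=> sF sG; rewrite /Shat_def; lin_tac F G sF sG. Qed.
Lemma That_lin (a : R) F G : smooth_mx F -> smooth_mx G ->
  That_def (fun x => a *: F x + G x) =
  fun x => a *: That_def F x + That_def G x.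
Proof. by move=> sF sG; rewrite /That_def; lin_tac F G sF sG. Qed.

Definition stokes := lift stokes_smooth stokes_lin.
Definition laplacian4 :=
  lift (@smooth_laplacian_mx R 1 (3 + 1)) (@laplacian_mx_lin R 1 (3 + 1)).
Definition opP := lift P_smooth P_lin.
Definition opR := lift R_smooth R_lin.
Definition opT := lift T_smooth T_lin.
Definition opQhat := lift Qhat_smooth Qhat_lin.
Definition opShat := lift Shat_smooth Shat_lin.
Definition opThat := lift That_smooth That_lin.

Local Notation mu := (@lebesgue_measure R).

Definition integral3 (f : X -> R) : R :=
  \int[(mu \x mu \x mu)%E]_t f (\row_i [:: t.1.1; t.1.2; t.2]`_i).

Definition L2_pairing (u v : Cinf) : R :=
  integral3 (fun x => dot (u x) (v x)).

Definition compactly_supported (u : Cinf) : Prop :=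
  compact (closure [set x | u x != 0]).

(* Values are row vectors, so the coefficient matrices act on the right. *)
Definition differential_operator (A : Cinf -> Cinf) : Prop :=
  exists n (c : {ffun 'I_3 -> 'I_n} -> X -> 'M[R]_(3 + 1)),
    (forall a, smooth_mx (c a)) /\
    forall u x,
      A u x = \sum_a (\row_j mpartial a (entry 0 j u) x) *m c a x.

Definition formal_adjoint (A B : {linear Cinf -> Cinf}) : Prop :=
  differential_operator B /\
  forall u v, compactly_supported u -> compactly_supported v ->
    L2_pairing (A u) v = L2_pairing u (B v).

End smooth_functions.

(* Main.v *)
Require Import Defs.
From HB Require Import structures.
From mathcomp Require Import all_boot all_order all_algebra.
From mathcomp Require Import all_classical all_reals all_analysis.
From mathcomp Require Import ring lra.

(* The four identities are polynomial identities between the coordinates, the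
   unknown functions and their partial derivatives, once mixed partial
   derivatives are known to commute and P^*, R^* are explicit. Integration by
   parts (Fubini and the fundamental theorem of calculus) shows that the
   explicit operators are formal adjoints. A formal adjoint that is a
   differential operator is unique: two candidates agree on compactly supported
   functions, because their difference w there satisfies <w, w> = 0, and both
   are local. *)

(** Derivatives are kept in the fixed order d_0^a d_1^b d_2^c, so that commutation is built into the
    syntax, the jets can be treated as independent indeterminates, and each identity becomes an
    equality of polynomials. Green's formula fits the same scheme once the jets of both arguments
    are numbered side by side and the boundary term is written explicitly. The obstacle is that
    [formal_adjoint] tests B on compactly supported functions only, whereas the golden identities
    apply it to arbitrary smooth ones. Locality carries the information from the former to the
    latter, and it also makes (B - C) v an admissible test function. *)

Set Implicit Arguments.
Unset Strict Implicit.
Unset Printing Implicit Defensive.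

Import Order.TTheory GRing.Theory Num.Theory.
Import numFieldNormedType.Exports.

Local Open Scope classical_set_scope.
Local Open Scope ring_scope.

(** * Formal differential expressions *)

Section formal.
Variable R : realType.

(* [Var i] is the [i]-th coordinate and [Jet k a b c] the derivative
   d_0^a d_1^b d_2^c of the [k]-th unknown function: since derivatives of
   expressions are again expressions, identities between differential operators
   become polynomial identities in the coordinates and the jets. *)
Inductive expr :=
  | Cst of R
  | Var of nat
  | Jet of nat & nat & nat & nat
  | Add of expr & expr
  | Mul of expr & expr.

Local Infix "[+]" := Add (at level 50, left associativity).
Local Infix "[*]" := Mul (at level 40, left associativity).

(** Only the directions 0, 1, 2 are meant. Raising an exponent in place presupposes that partial
    derivatives commute; [partial_interp] justifies it. *)
Fixpoint fderiv (i : nat) (e : expr) : expr :=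
  match e with
  | Cst _ => Cst 0
  | Var j => Cst (if eqn i j then 1 else 0)
  | Jet k a b c =>
      match i with
      | 0%N => Jet k a.+1 b c
      | 1%N => Jet k a b.+1 c
      | _ => Jet k a b c.+1
      end
  | e [+] f => fderiv i e [+] fderiv i f
  | e [*] f => fderiv i e [*] f [+] e [*] fderiv i f
  end.

Fixpoint feval (x : nat -> R) (j : nat -> nat -> nat -> nat -> R) e : R :=
  match e with
  | Cst a => a
  | Var i => x i
  | Jet k a b c => j k a b c
  | e [+] f => feval x j e + feval x j f
  | e [*] f => feval x j e * feval x j f
  end.

Implicit Types (e : expr) (v w F G : nat -> expr) (i j k : nat).

Definition nxt i : nat :=
  match i with 0%N => 1%N | 1%N => 2%N | _ => 0%N end.

Definition sum3 v := v 0%N [+] v 1%N [+] v 2%N.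
Definition sum4 v := sum3 v [+] v 3%N.
Definition fopp e := Cst (-1) [*] e.
Definition flap e := sum3 (fun i => fderiv i (fderiv i e)).
Definition fgrad e i := fderiv i e.
Definition fdiv v := sum3 (fun i => fderiv i (v i)).
Definition fdot v w := sum3 (fun i => v i [*] w i).
Definition fcross v w i :=
  v (nxt i) [*] w (nxt (nxt i)) [+] fopp (v (nxt (nxt i)) [*] w (nxt i)).
Definition fcurl v i :=
  fderiv (nxt i) (v (nxt (nxt i))) [+] fopp (fderiv (nxt (nxt i)) (v (nxt i))).
Definition fjoin v e k :=
  match k with 0%N | 1%N | 2%N => v k | _ => e end.
Definition dot4 F G := fdot F G [+] F 3%N [*] G 3%N.
Definition flap4 F i := flap (F i).
Definition flin a F b G i := Cst a [*] F i [+] Cst b [*] G i.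

Definition fstokes F :=
  fjoin (fun i => flap (F i) [+] fopp (fgrad (F 3%N) i)) (fdiv F).
Definition fcommonPR a F i :=
  Cst a [*] F i [+] fopp (Cst (1 / 2) [*] fdiv F [*] Var i)
  [+] fopp (Cst (1 / 2) [*]
        fcross Var (fun l => fcurl F l [+] fopp (fgrad (F 3%N) l)) i).
Definition fopP F := fjoin (fcommonPR (3 / 2) F) (Cst (-2) [*] fdiv F).
Definition fopR F :=
  fjoin (fcommonPR (5 / 2) F) (Cst (- (1 / 2)) [*] fdot Var F).
Definition fopT F :=
  fjoin (fun i => Cst (1 / 3) [*] F 3%N [*] Var i
                  [+] Cst (1 / 12) [*] fdot Var Var [*] F i)
        (Cst (7 / 3) [*] F 3%N [+] Cst (1 / 3) [*] fdot Var F).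
Definition fQhat F := fjoin (fun i => fdiv F [*] Var i) (Cst 0).
Definition fShat F :=
  fjoin (fun i => flap (F 3%N) [*] Var i [+] Cst 2 [*] fgrad (F 3%N) i) (Cst 0).
Definition fThat F :=
  fjoin (fun i => Cst (1 / 2) [*] fdot Var Var [*] fgrad (F 3%N) i)
        (Cst 6 [*] F 3%N [+] Cst 2 [*] fdot Var (fgrad (F 3%N))).

(** Coefficient matrices act on the right, as in [differential_operator]: [k] is the input
    component, [j] the output one. *)
Definition fdiffop (c0 : nat -> nat -> expr) (c : nat -> nat -> nat -> expr)
    F j :=
  sum4 (fun k => F k [*] c0 k j)
  [+] sum3 (fun i => sum4 (fun k => fderiv i (F k) [*] c i k j)).

Definition delta i j e := if eqn i j then e else Cst 0.

(* Integrating by parts,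
     P^*(u, p) = (3/2 u + 1/2 grad(x.u) + 1/2 curl(x ^ u) + 2 grad p,
                  - 1/2 x.curl u),
     R^*(u, p) = (5/2 u + 1/2 grad(x.u) + 1/2 curl(x ^ u) - 1/2 p x,
                  - 1/2 x.curl u),
   where curl(x ^ u) = (div u) x - 2 u - (x.grad) u. [adj_coef0] collects the
   terms of order 0 and [adj_coef1 a i] the coefficients of d_i; the scalar part
   has index 3. *)
Definition adj_coef0 (a b : R) k j : expr :=
  match j, k with
  | 3%N, _ => Cst 0
  | _, 3%N => Cst b [*] Var j
  | _, _ => delta k j (Cst a)
  end.
Definition adj_coef1 (a : R) i k j : expr :=
  match j, k with
  | 3%N, 3%N => Cst 0
  | 3%N, _ => Cst (- (1 / 2)) [*] (delta k (nxt i) (Var (nxt (nxt i)))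
                                   [+] fopp (delta i (nxt k) (Var (nxt i))))
  | _, 3%N => delta i j (Cst a)
  | _, _ => Cst (1 / 2) [*] (delta i j (Var k) [+] delta i k (Var j)
                             [+] fopp (delta k j (Var i)))
  end.
(** In order 0, grad(x.u) contributes u and curl(x ^ u) contributes -2 u, whence 3/2 + 1/2 - 1 = 1
    here and 5/2 + 1/2 - 1 = 2 for [fRs]. *)
Definition fPs := fdiffop (adj_coef0 1 0) (adj_coef1 2).
Definition fRs := fdiffop (adj_coef0 2 (- (1 / 2))) (adj_coef1 0).

Definition jets k := Jet k 0%N 0%N 0%N.

(* The boundary term of the integrations by parts, for the pair of arguments
   (v, w) = jets 0..3 and (u, p) = jets 4..7:
     - 1/2 (x.u) v - 1/2 v ^ (u ^ x) + 1/2 w (u ^ x) + c p v. *)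
Definition flux c i : expr :=
  let u k := jets k.+4 in let b := fcross u Var in
  Cst (- (1 / 2)) [*] fdot Var u [*] jets i
  [+] Cst (- (1 / 2)) [*] fcross jets b i
  [+] (Cst (1 / 2) [*] jets 3%N [*] b i [+] Cst c [*] jets 7%N [*] jets i).

(** Coordinates and jets take arbitrary values, so this is an equality of polynomial functions; it
    implies equality of the operators. *)
Definition feq F G :=
  forall x d k, (k < 4)%N -> feval x d (F k) = feval x d (G k).

(** Unfolds the expressions but not the operations of [R]; the rational coefficients call for
    [field]. *)
Ltac feval_field := cbv beta iota zeta delta [feval fderiv fopp flap fdot fdiv
  fcross fcurl fgrad fjoin fstokes fcommonPR fopP fopR fopT fQhat fShat fThat
  fdiffop delta sum3 sum4 adj_coef0 adj_coef1 fPs fRs flin flap4 jets flux dot4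
  eqn nxt]; by field.

Lemma formal_AP_RB : feq (fstokes (fopP jets)) (fopR (flap4 jets)).
Proof. by move=> x d [|[|[|[|//]]]] _; feval_field. Qed.

(** The parameter is free because the hatted operators solve the homogeneous system B Qhat = Shat A,
    P Qhat + That A = 0, R Shat + A That = 0. *)
Lemma formal_BQ_SA lambda :
  feq (flap4 (flin (1 / 3) (fRs jets) lambda (fQhat jets)))
      (flin (1 / 3) (fPs (fstokes jets)) lambda (fShat (fstokes jets))).
Proof. by move=> x d [|[|[|[|//]]]] _; feval_field. Qed.

Lemma formal_PQ_TA lambda :
  feq (fun i => fopP (flin (1 / 3) (fRs jets) lambda (fQhat jets)) i
         [+] flin 1 (fopT (fstokes jets)) lambda (fThat (fstokes jets)) i)
      jets.
Proof. by move=> x d [|[|[|[|//]]]] _; feval_field. Qed.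

Lemma formal_RS_AT lambda :
  feq (fun i => fopR (flin (1 / 3) (fPs jets) lambda (fShat jets)) i
         [+] fstokes (flin 1 (fopT jets) lambda (fThat jets)) i)
      jets.
Proof. by move=> x d [|[|[|[|//]]]] _; feval_field. Qed.

(** The constant -2 comes from the scalar part of P: -2 p div v = 2 v.grad p + div(-2 p v). The
    scalar part of R has no derivative, whence 0 in [formal_green_R]. *)
Lemma formal_green_P x d :
  feval x d (dot4 (fopP jets) (fun k => jets k.+4)) =
  feval x d (dot4 jets (fPs (fun k => jets k.+4)) [+] fdiv (flux (-2))).
Proof. feval_field. Qed.

Lemma formal_green_R x d :
  feval x d (dot4 (fopR jets) (fun k => jets k.+4)) =
  feval x d (dot4 jets (fRs (fun k => jets k.+4)) [+] fdiv (flux 0)).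
Proof. feval_field. Qed.

End formal.

(** * Symmetry of second derivatives *)

Section mixed_partials.
Variable R : realType.
Local Notation X := 'rV[R]_3.
Implicit Types f : X -> R.

(** Turns a directional derivative into a one-variable one, the form to which [MVT] applies. *)
Lemma is_derive_line f (y v : X) (s : R) : derivable f (y + s *: v) v ->
  is_derive s 1 (fun t : R => f (y + t *: v)) ('D_v f (y + s *: v)).
Proof.
move=> df.
have E : (fun h : R =>
      h^-1 *: (f (y + (h *: (1 : R) + s) *: v) - f (y + s *: v))) =
    (fun h : R => h^-1 *: (f (h *: v + (y + s *: v)) - f (y + s *: v))).
  apply/funext => h; congr (_ *: (f _ - _)).
  by rewrite scalerDl /GRing.scale /= mulr1 addrCA.
split; first by rewrite /derivable /= E.
by rewrite /derive /= E.
Qed.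

Lemma smooth_line_derive f i (y : X) (s : R) : smooth f ->
  is_derive s 1 (fun t : R => f (y + t *: 'e_i)) (partial i f (y + s *: 'e_i)).
Proof. by move=> sf; apply: is_derive_line; exact: smooth_derivable. Qed.

Lemma smooth_continuous f : smooth f -> continuous f.
Proof. by move/(_ 0%N). Qed.

(** Mean value theorem twice: in direction [i] for the difference [g] of two translates, then in
    direction [j] for [partial i f]. The left side is symmetric in [i] and [j], which is what
    [partialC] exploits. *)
Lemma second_difference f i j (x : X) (h : R) : smooth f -> 0 < h ->
  exists s t : R, [/\ 0 < s < h, 0 < t < h &
    f (x + h *: 'e_i + h *: 'e_j) - f (x + h *: 'e_i)
    - (f (x + h *: 'e_j) - f x) =
    partial j (partial i f) (x + s *: 'e_i + t *: 'e_j) * h * h].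
Proof.
move=> sf h0.
pose g (s : R) := f (x + h *: 'e_j + s *: 'e_i) - f (x + s *: 'e_i).
pose g' (s : R) := partial i f (x + h *: 'e_j + s *: 'e_i)
                   - partial i f (x + s *: 'e_i).
have dg (s : R) : is_derive s 1 g (g' s).
  by apply: is_deriveB; exact: smooth_line_derive.
have cont (k : R -> R) (k' : R -> R) : (forall s : R, is_derive s 1 k (k' s)) ->
    {within `[0, h], continuous k}.
  move=> dk; apply: derivable_within_continuous => s _.
  by have [] := dk s.
have [s sh gE] := MVT h0 (fun s _ => dg s) (cont _ _ dg).
pose k (t : R) := partial i f (x + s *: 'e_i + t *: 'e_j).
pose k' (t : R) := partial j (partial i f) (x + s *: 'e_i + t *: 'e_j).
have dk (t : R) : is_derive t 1 k (k' t).
  by apply: smooth_line_derive; exact: smooth_partial.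
have [t th kE] := MVT h0 (fun t _ => dk t) (cont _ _ dk).
exists s, t; split; [by move: sh; rewrite in_itv|by move: th; rewrite in_itv|].
move: gE kE; rewrite /g /g' /k /k' !subr0 !scale0r !addr0 => gE kE.
rewrite -/(k' t) in kE *.
rewrite -kE [x + s *: 'e_i + h *: 'e_j]addrAC -gE.
by rewrite [x + h *: 'e_j + h *: 'e_i]addrAC; ring.
Qed.

Lemma nbhs_boxP (x : X) (P : set X) : nbhs x P <->
  exists2 e : R, 0 < e & forall y : X, (forall j, `|x 0 j - y 0 j| < e) -> P y.
Proof.
apply: (iff_trans (nbhs_ballP x P)).
split=> -[e /= e0 eP]; exists e => //= y xy; apply: eP.
  by split=> // i j; rewrite (ord1 i) -ball_normE; exact: xy.
by move=> j; have := xy.2 0 j; rewrite -ball_normE.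
Qed.

(** If the two mixed derivatives differed by d > 0 at x, continuity would keep each within d/2 of
    its value at x on a small cube. But both expansions of the same second difference, divided by
    h^2, give them a common value at two points of that cube. *)
Lemma partialC f i j : smooth f ->
  partial i (partial j f) = partial j (partial i f).
Proof.
move=> sf; apply/funext => x; apply/eqP; rewrite -subr_eq0; apply/negPn/negP.
rewrite -normr_gt0; set d := `|_|; move=> d0.
have near_corner (g : X -> R) : continuous g -> exists2 e : R, 0 < e &
    forall (k l : 'I_3) (s t : R), 0 < s < e -> 0 < t < e ->
    `|g x - g (x + s *: 'e_k + t *: 'e_l)| < d / 2.
  move=> /(_ x)/cvgrPdist_lt /(_ (d / 2)).
  have d2 : 0 < d / 2 by rewrite divr_gt0.
  move=> /(_ d2)/nbhs_boxP[e e0 ge].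
  (* Halved because for [k = l] both displacements add up in one coordinate. *)
  exists (e / 2); first by rewrite divr_gt0.
  move=> k l s t /andP[s0 se] /andP[t0 te]; apply: ge => m.
  rewrite !mxE /= -addrA opprD addNKr normrN.
  by case: (_ == _); case: (_ == _); rewrite /= ?mulr1 ?mulr0 ger0_norm; lra.
have cont (k l : 'I_3) : continuous (partial k (partial l f)).
  by apply: smooth_continuous; do 2 apply: smooth_partial.
have [e e0 He] := near_corner _ (cont i j).
have [e' e'0 He'] := near_corner _ (cont j i).
pose h := Num.min e e'.
have h0 : 0 < h by rewrite lt_min e0.
have [s [t [/andP[s0 sh] /andP[t0 th] E1]]] := second_difference i j x sf h0.
have [s' [t' [/andP[s'0 s'h] /andP[t'0 t'h] E2]]] :=
  second_difference j i x sf h0.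
move: sh th s'h t'h; rewrite !lt_min => /andP[se se'] /andP[te te'].
move=> /andP[s'e s'e'] /andP[t'e t'e'].
have A := He j i s' t'; have B := He' i j s t.
rewrite s'0 t'0 s'e t'e /= in A; rewrite s0 t0 se' te' /= in B.
have {}A := A isT isT; have {}B := B isT isT.
have E : partial i (partial j f) (x + s' *: 'e_j + t' *: 'e_i) =
    partial j (partial i f) (x + s *: 'e_i + t *: 'e_j).
  apply: (mulIf (lt0r_neq0 h0)); apply: (mulIf (lt0r_neq0 h0)).
  apply: etrans (esym E2) _; apply: etrans _ E1.
  have -> : x + h *: 'e_j + h *: 'e_i = x + h *: 'e_i + h *: 'e_j.
    exact: addrAC.
  move: (f (x + h *: 'e_i + h *: 'e_j)) (f (x + h *: 'e_i)).
  move: (f (x + h *: 'e_j)) (f x).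
  by move=> *; ring.
rewrite E in A; have tri (a b c : R) :
    `|a - c| < d / 2 -> `|b - c| < d / 2 -> `|a - b| < d.
  move=> ac bc; rewrite (_ : a - b = (a - c) - (b - c)); last by ring.
  by rewrite [ltRHS]splitr; apply: le_lt_trans (ler_normB _ _) _; exact: ltrD.
by have := tri _ _ _ A B; rewrite ltxx.
Qed.

End mixed_partials.

(** * Interpretation of formal expressions *)

Section interpretation.
Variable R : realType.
Local Notation X := 'rV[R]_3.
Local Notation R4 := 'rV[R]_(3 + 1).
Local Notation expr := (expr R).

Lemma partialD i (f g : X -> R) : smooth f -> smooth g ->
  partial i (fun x => f x + g x) = fun x => partial i f x + partial i g x.
Proof.
move=> sf sg; apply/funext => x.
by rewrite /partial deriveD//; exact: smooth_derivable.
Qed.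

Lemma partialM i (f g : X -> R) : smooth f -> smooth g ->
  partial i (fun x => f x * g x) =
  fun x => partial i f x * g x + f x * partial i g x.
Proof.
move=> sf sg; apply/funext => x.
rewrite /partial deriveM//; try exact: smooth_derivable.
by rewrite addrC [g x *: _]mulrC.
Qed.

Lemma partial_cst i (c : R) : partial i (fun=> c) = fun=> 0.
Proof. by apply/funext => x; rewrite /partial derive_cst. Qed.

Lemma smooth_iter_partial n i (f : X -> R) : smooth f ->
  smooth (iter n (partial i) f).
Proof. by move=> sf; elim: n => //= n; exact: smooth_partial. Qed.

Lemma iter_partialC n i j (f : X -> R) : smooth f ->
  partial i (iter n (partial j) f) = iter n (partial j) (partial i f).
Proof.
move=> sf; elim: n => //= n <-; apply: partialC; exact: smooth_iter_partial.
Qed.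

Definition jet (u : nat -> X -> R) k a b c : X -> R :=
  iter a (partial (inord 0))
    (iter b (partial (inord 1)) (iter c (partial (inord 2)) (u k))).

(** Coordinates of index 3 or more are read as 0, so that every expression denotes a smooth
    function. *)
Definition interp u (e : expr) : X -> R :=
  fun x => feval (fun i => if (i < 3)%N then x 0 (inord i) else 0)
    (fun k a b c => jet u k a b c x) e.

Section family.
Variable u : nat -> X -> R.
Hypothesis su : forall k, smooth (u k).

Lemma smooth_jet k a b c : smooth (jet u k a b c).
Proof. by do 3 apply: smooth_iter_partial. Qed.

Lemma smooth_interp e : smooth (interp u e).
Proof.
elim: e => [c|i|k a b c|e IHe f IHf|e IHe f IHf].
- exact: smooth_cst.
- rewrite /interp /=; case: (i < 3)%N; [exact: smooth_coord|exact: smooth_cst].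
- exact: smooth_jet.
- exact: smoothD.
- exact: smoothM.
Qed.

(** Symmetry of second derivatives enters here: a derivative in direction 1 or 2 has to move past
    the outer ones to reach its place in the normal order. *)
Lemma partial_interp i e : (i < 3)%N ->
  partial (inord i) (interp u e) = interp u (fderiv i e).
Proof.
move=> i3; elim: e => [c|j|k a b c|e IHe f IHf|e IHe f IHf].
- exact: partial_cst.
- rewrite /interp /=; case: (ltnP j 3) => j3; last first.
    rewrite partial_cst; congr (fun=> _).
    by case: (@eqnP i j) => // ij; rewrite leqNgt -ij i3 in j3.
  rewrite partial_coord; apply/funext => x /=.
  rewrite -val_eqE /= !inordK // eqE /=.
  by case: (eqn i j).
- case: i i3 => [|[|[|//]]] _; rewrite /interp /=.
  + by [].
  + by rewrite /jet iter_partialC //; do 2 apply: smooth_iter_partial.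
  + rewrite /jet iter_partialC; last by do 2 apply: smooth_iter_partial.
    rewrite iter_partialC; last exact: smooth_iter_partial.
    by rewrite -iterS.
- by rewrite [LHS](partialD _ (smooth_interp e) (smooth_interp f)) IHe IHf.
- by rewrite [LHS](partialM _ (smooth_interp e) (smooth_interp f)) IHe IHf.
Qed.

Lemma add1_inord i : (i < 3)%N -> (inord i + 1 : 'I_3) = inord (nxt i).
Proof. by case: i => [|[|[|//]]] _; apply/val_inj; rewrite /= !inordK. Qed.

Lemma add2_inord i : (i < 3)%N -> (inord i + 2 : 'I_3) = inord (nxt (nxt i)).
Proof. by case: i => [|[|[|//]]] _; apply/val_inj; rewrite /= !inordK. Qed.

Lemma nxt_lt3 i : (nxt i < 3)%N.
Proof. by case: i => [|[|]]. Qed.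

(** The lemmas below are syntax-directed rules for this relation; [rep_tac] chains them along the
    definition of each operator. *)
Definition rep n (F : X -> 'rV[R]_n.+1) (es : nat -> expr) :=
  forall k, (k < n.+1)%N -> entry 0 (inord k) F = interp u (es k).

Lemma sum_ord3 (F : 'I_3 -> R) :
  \sum_i F i = F (inord 0) + F (inord 1) + F (inord 2).
Proof.
rewrite !big_ord_recr big_ord0 /= add0r.
by congr (F _ + F _ + F _); apply/val_inj; rewrite /= ?inordK.
Qed.

Lemma rep_vpart F es : @rep 3 F es -> @rep 2 (vpart F) es.
Proof.
move=> H k k3; rewrite -H ?(ltnW k3)//; last by rewrite ltnS ltnW.
apply/funext => x; rewrite /entry mxE; congr (F x 0 _).
by apply/val_inj; rewrite /= !inordK // ltnS ltnW.
Qed.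

Lemma rep_spart F es : @rep 3 F es -> spart F = interp u (es 3%N).
Proof.
move=> H; rewrite -H //; apply/funext => x; rewrite /entry /spart mxE.
by congr (F x 0 _); apply/val_inj; rewrite /= !inordK.
Qed.

Lemma rep_join v w es e : @rep 2 v es -> w = interp u e ->
  @rep 3 (join v w) (fjoin es e).
Proof.
move=> Hv Hw k k4; apply/funext => x; rewrite /entry /join.
have [k3|] := ltnP k 3.
  rewrite (_ : inord k = lshift 1 (inord k : 'I_3)); last first.
    by apply/val_inj; rewrite /= !inordK.
  apply: etrans (row_mxEl _ _ _ _) _; rewrite -/(entry 0 (inord k) v x) Hv //.
  by case: k k3 {k4} => [|[|[|]]].
case: k k4 => [|[|[|[|//]]]] // _ _.
rewrite (_ : inord 3 = rshift 3 (0 : 'I_1)); last first.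
  by apply/val_inj; rewrite /= !inordK.
by apply: etrans (row_mxEr _ _ _ _) _; rewrite mxE eqxx mulr1n Hw.
Qed.

Lemma rep_add n (F G : X -> 'rV[R]_n.+1) e f : rep F e -> rep G f ->
  rep (fun x => F x + G x) (fun i => Add (e i) (f i)).
Proof.
move=> HF HG k kn; apply/funext => x; rewrite /entry mxE.
by rewrite -!/(entry 0 _ _ x) HF // HG.
Qed.

Lemma rep_scale n g (F : X -> 'rV[R]_n.+1) d e : g = interp u d -> rep F e ->
  rep (fun x => g x *: F x) (fun i => Mul d (e i)).
Proof.
move=> Hg HF k kn; apply/funext => x; rewrite /entry mxE.
by rewrite -!/(entry 0 _ _ x) HF // Hg.
Qed.

Lemma rep_opp n (F : X -> 'rV[R]_n.+1) e : rep F e ->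
  rep (fun x => - F x) (fun i => fopp (e i)).
Proof.
move=> HF k kn; apply/funext => x; rewrite /entry mxE.
by rewrite -!/(entry 0 _ _ x) HF // /interp /= mulN1r.
Qed.

Lemma rep_id : rep id (@Var R).
Proof.
by move=> k k3; apply/funext => x; rewrite /entry /interp /= k3.
Qed.

Lemma rep_cross v w e f : rep v e -> rep w f ->
  rep (fun x => cross (v x) (w x)) (fcross e f).
Proof.
move=> Hv Hw k k3; apply/funext => x.
rewrite /entry mxE add1_inord // add2_inord // -!/(entry 0 _ _ x).
by rewrite !Hv ?Hw ?nxt_lt3 // /interp /= mulN1r.
Qed.

Lemma rep_grad f e : f = interp u e -> rep (grad f) (fgrad e).
Proof.
move=> -> k k3; rewrite -partial_interp //.
by apply/funext => x; rewrite /entry mxE.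
Qed.

Lemma rep_curl v e : rep v e -> rep (curl v) (fcurl e).
Proof.
move=> Hv k k3; apply/funext => x.
rewrite /entry mxE add1_inord // add2_inord //.
by rewrite !Hv ?nxt_lt3 // !partial_interp ?nxt_lt3 // /interp /= mulN1r.
Qed.

Lemma interp_div v e : rep v e -> div v = interp u (fdiv e).
Proof.
by move=> Hv; apply/funext => x; rewrite /div sum_ord3 !Hv // !partial_interp.
Qed.

Lemma interp_dot v w e f : @rep 2 v e -> rep w f ->
  (fun x => dot (v x) (w x)) = interp u (fdot e f).
Proof.
move=> Hv Hw; apply/funext => x; rewrite /dot sum_ord3 -!/(entry 0 _ _ x).
by rewrite !Hv // !Hw.
Qed.

Lemma interp_laplacian f e : f = interp u e -> laplacian f = interp u (flap e).
Proof.
by move=> ->; apply/funext => x; rewrite /laplacian sum_ord3 !partial_interp.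
Qed.

Lemma rep_laplacian n (F : X -> 'rV[R]_n.+1) e : rep F e ->
  rep (laplacian_mx F) (fun i => flap (e i)).
Proof.
move=> HF k kn; rewrite -(interp_laplacian (HF k kn)).
by apply/funext => x; rewrite /entry mxE.
Qed.

Lemma interp_cst c : (fun=> c) = interp u (Cst c).
Proof. by []. Qed.

Lemma interp_add f g d e : f = interp u d -> g = interp u e ->
  (fun x => f x + g x) = interp u (Add d e).
Proof. by move=> -> ->. Qed.

Lemma interp_mul f g d e : f = interp u d -> g = interp u e ->
  (fun x => f x * g x) = interp u (Mul d e).
Proof. by move=> -> ->. Qed.

Ltac rep_tac := repeat first [assumption | exact: rep_id | exact: interp_cst
  | apply: rep_join | apply: rep_add | apply: rep_opp | apply: rep_scale
  | apply: rep_cross | apply: rep_curl | apply: rep_grad | apply: rep_laplacian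
  | apply: interp_div | apply: interp_laplacian | apply: interp_dot
  | apply: interp_add | apply: interp_mul | apply: rep_vpart
  | apply: rep_spart].

Section operators.
Variables (F : X -> R4) (e : nat -> expr).
Hypothesis HF : @rep 3 F e.

Lemma rep_stokes : @rep 3 (stokes_def F) (fstokes e).
Proof. rep_tac. Qed.

Lemma rep_P : @rep 3 (P_def F) (fopP e).
Proof. rep_tac. Qed.

Lemma rep_R : @rep 3 (R_def F) (fopR e).
Proof. rep_tac. Qed.

Lemma rep_T : @rep 3 (T_def F) (fopT e).
Proof. rep_tac. Qed.

Lemma rep_Qhat : @rep 3 (Qhat_def F) (fQhat e).
Proof. rep_tac. Qed.

Lemma rep_Shat : @rep 3 (Shat_def F) (fShat e).
Proof. rep_tac. Qed.

Lemma rep_That : @rep 3 (That_def F) (fThat e).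
Proof. rep_tac. Qed.

End operators.

End family.
End interpretation.

(** * The golden identities for the explicit adjoints *)

Section operators.
Variable R : realType.
Local Notation X := 'rV[R]_3.
Local Notation R4 := 'rV[R]_(3 + 1).
Local Notation expr := (expr R).

Lemma sum_ord4 (F : 'I_4 -> R) :
  \sum_i F i = F (inord 0) + F (inord 1) + F (inord 2) + F (inord 3).
Proof.
rewrite !big_ord_recr big_ord0 /= add0r.
by congr (F _ + F _ + F _ + F _); apply/val_inj; rewrite /= ?inordK.
Qed.

Fixpoint jet_free (e : expr) : bool :=
  match e with
  | Cst _ | Var _ => true
  | Jet _ _ _ _ => false
  | Add e f | Mul e f => jet_free e && jet_free f
  end.

Lemma feval_jet_free x j j' (e : expr) : jet_free e ->
  feval x j e = feval x j' e.
Proof.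
by elim: e => //= e IHe f IHf /andP[/IHe -> /IHf ->].
Qed.

(** The unknowns are set to 0: coefficients are meant to be [jet_free], so any family gives the same
    value. *)
Definition coef_mx (c : nat -> nat -> expr) : X -> 'M[R]_(3 + 1) :=
  fun x => \matrix_(k, j) interp (fun _ _ => 0) (c k j) x.

Lemma smooth_coef_mx c : smooth_mx (coef_mx c).
Proof.
move=> k j; rewrite (_ : entry k j _ = interp (fun _ _ => 0) (c k j)).
  by apply: smooth_interp => n; exact: smooth_cst.
by apply/funext => x; rewrite /entry mxE.
Qed.

Definition diffop1 c0 (c : nat -> nat -> nat -> expr) (F : X -> R4) : X -> R4 :=
  fun x => F x *m coef_mx c0 x +
    \sum_(i < 3) (\row_j partial i (entry 0 j F) x) *m coef_mx (c i) x.

Lemma smooth_mxM m n p (F : X -> 'M[R]_(m, n)) (G : X -> 'M[R]_(n, p)) :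
  smooth_mx F -> smooth_mx G -> smooth_mx (fun x => F x *m G x).
Proof.
move=> sF sG i j; rewrite (_ : entry i j _ =
  fun x => \sum_k entry i k F x * entry k j G x).
  by apply: smooth_sum => k; apply: smoothM; [exact: sF|exact: sG].
by apply/funext => x; rewrite /entry mxE.
Qed.

Lemma smooth_mx_sum m n p (h : 'I_p -> X -> 'M[R]_(m, n)) :
  (forall l, smooth_mx (h l)) -> smooth_mx (fun x => \sum_l h l x).
Proof.
move=> sh i j; rewrite (_ : entry i j _ = fun x => \sum_l entry i j (h l) x).
  by apply: smooth_sum => l; exact: sh.
by apply/funext => x; rewrite /entry summxE.
Qed.

Lemma diffop1_smooth c0 c F : smooth_mx F -> smooth_mx (diffop1 c0 c F).
Proof.
move=> sF; apply: smooth_mxD; first exact: smooth_mxM sF (@smooth_coef_mx _).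
apply: (@smooth_mx_sum _ _ _ (fun i x => _)) => i.
apply: smooth_mxM (@smooth_coef_mx _) => a j.
rewrite (_ : entry a j _ = partial i (entry 0 j F)).
  by apply: smooth_partial; exact: sF.
by apply/funext => x; rewrite /entry mxE.
Qed.

Lemma diffop1_lin c0 c (a : R) F G : smooth_mx F -> smooth_mx G ->
  diffop1 c0 c (fun x => a *: F x + G x) =
  fun x => a *: diffop1 c0 c F x + diffop1 c0 c G x.
Proof.
move=> sF sG; apply/funext => x; rewrite /diffop1.
rewrite mulmxDl -scalemxAl scalerDr -!addrA; congr (_ + _).
rewrite addrCA; congr (_ + _); rewrite scaler_sumr -big_split /=.
apply: eq_bigr => i _; rewrite scalemxAl -mulmxDl; congr (_ *m _).
by apply/rowP => j; rewrite !mxE entry_lin partial_lin.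
Qed.

Definition diffop c0 c : {linear Cinf R -> Cinf R} :=
  Defs.lift (@diffop1_smooth c0 c) (@diffop1_lin c0 c).

(** The multi-index of d_i; exponents below 2 suffice for operators of order 1. *)
Definition expo (i : 'I_3) : {ffun 'I_3 -> 'I_2} := [ffun l => inord (l == i)].

Lemma enum_ord3 : enum 'I_3 = [:: inord 0; inord 1; inord 2].
Proof.
apply: (inj_map val_inj); rewrite val_enum_ord /=.
by rewrite !inordK.
Qed.

Lemma mpartial_expo i (f : X -> R) : mpartial (expo i) f = partial i f.
Proof.
rewrite /mpartial enum_ord3 /= !ffunE -!val_eqE /= !inordK ?ltnS ?leq_b1 //.
by case: i => [[|[|[|//]]] Hi] /=; congr (partial _ f); apply/val_inj;
  rewrite /= inordK.
Qed.

Lemma mpartial0 (f : X -> R) :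
  mpartial ([ffun=> ord0] : {ffun 'I_3 -> 'I_2}) f = f.
Proof. by rewrite /mpartial enum_ord3 /= !ffunE. Qed.

Lemma diffop_differential c0 c : differential_operator (diffop c0 c).
Proof.
pose z : {ffun 'I_3 -> 'I_2} := [ffun=> ord0].
(* A coefficient placed at the multi-index [b] and 0 at the others, so that the sum over all
   multi-indices collapses. *)
pose only (b a : {ffun 'I_3 -> 'I_2}) d :=
  if a == b then coef_mx d else fun=> 0.
have smooth_only b a d : smooth_mx (only b a d).
  by rewrite /only; case: ifP => _; [exact: smooth_coef_mx|exact: smooth_mx0].
have sum_only b d (r : {ffun 'I_3 -> 'I_2} -> R4) x :
    \sum_a r a *m only b a d x = r b *m coef_mx d x.
  rewrite (bigD1 b) //= /only eqxx big1 ?addr0 // => a /negPf ->.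
  by rewrite mulmx0.
exists 2%N, (fun a x => only z a c0 x + \sum_(i < 3) only (expo i) a (c i) x).
split=> [a|u x].
  by apply: smooth_mxD => //; apply: (@smooth_mx_sum _ _ _ (fun i x => _)).
under eq_bigr do rewrite mulmxDr mulmx_sumr.
rewrite big_split exchange_big /= sum_only; congr (_ *m _ + _).
  by apply/rowP => j; rewrite !mxE mpartial0.
apply: eq_bigr => i _; rewrite sum_only; congr (_ *m _).
by apply/rowP => j; rewrite !mxE mpartial_expo.
Qed.

Section representation.
Variable u : nat -> X -> R.
Hypothesis su : forall k, smooth (u k).

Lemma rep_diffop1 c0 c F e :
  (forall k j, (k < 4)%N -> (j < 4)%N -> jet_free (c0 k j)) ->
  (forall i k j, (i < 3)%N -> (k < 4)%N -> (j < 4)%N -> jet_free (c i k j)) ->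
  @rep R u 3 F e -> @rep R u 3 (diffop1 c0 c F) (fdiffop c0 c e).
Proof.
move=> fc0 fc HF j j4; apply/funext => x.
have E (r : R4) d (g : nat -> expr) : (forall k, (k < 4)%N -> jet_free (d k)) ->
    (forall k, (k < 4)%N -> r 0 (inord k) = interp u (g k) x) ->
    forall d', (forall k, d' k j = d k) ->
    (r *m coef_mx d' x) 0 (inord j) =
    interp u (sum4 (fun k => Mul (g k) (d k))) x.
  move=> fd rg d' dE; rewrite mxE sum_ord4.
  have E k : (k < 4)%N -> r 0 (inord k) * coef_mx d' x (inord k) (inord j) =
      interp u (Mul (g k) (d k)) x.
    move=> k4; rewrite rg // mxE (inordK k4) (inordK j4) dE /interp /=.
    by congr (_ * _); exact/feval_jet_free/fd.
  by rewrite (E 0%N) // (E 1%N) // (E 2%N) // (E 3%N).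
have H (e1 e2 : expr) :
  interp u (Add e1 e2) x = interp u e1 x + interp u e2 x by [].
have Ex k : (k < 4)%N -> F x 0 (inord k) = interp u (e k) x.
  by move=> k4; rewrite -HF.
have E0 := E (F x) (fun k => c0 k j) e (fun k k4 => fc0 k j k4 j4) Ex c0
  (fun=> erefl).
rewrite /fdiffop H -E0.
rewrite /entry /diffop1 mxE; congr (_ + _); rewrite summxE sum_ord3 /sum3 !H.
have D i : (i < 3)%N ->
  ((\row_l partial (inord i) (entry 0 l F) x)
     *m coef_mx (c (inord i : 'I_3)) x) 0 (inord j)
  = interp u (sum4 (fun k => Mul (fderiv i (e k)) (c i k j))) x.
  move=> i3; rewrite inordK //; apply: (E _ (fun k => c i k j)) => // k k4.
    exact: fc.
  by rewrite mxE HF // partial_interp.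
by rewrite (D 0%N) // (D 1%N) // (D 2%N).
Qed.

Lemma rep_eq F G e f : @rep R u 3 F e -> @rep R u 3 G f -> feq e f -> F = G.
Proof.
move=> HF HG ef; apply/funext => x; apply/rowP => k.
rewrite -[k]inord_val -!/(entry 0 _ _ x) HF // HG //.
exact: ef.
Qed.

Lemma rep_lin a b F G e f : @rep R u 3 F e -> @rep R u 3 G f ->
  @rep R u 3 (fun x => a *: F x + b *: G x) (flin a e b f).
Proof.
move=> HF HG; apply: rep_add; exact: rep_scale.
Qed.

Lemma rep_lin1 b F G e f : @rep R u 3 F e -> @rep R u 3 G f ->
  @rep R u 3 (fun x => F x + b *: G x) (flin 1 e b f).
Proof.
move=> HF HG; rewrite (_ : (fun x => _) = fun x => 1 *: F x + b *: G x).
  exact: rep_lin.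
by apply/funext => x; rewrite scale1r.
Qed.

Lemma interp_dot4 F G e f : @rep R u 3 F e -> @rep R u 3 G f ->
  (fun x => dot (F x) (G x)) = interp u (dot4 e f).
Proof.
move=> HF HG; apply/funext => x; rewrite /dot sum_ord4 -!/(entry 0 _ _ x).
by rewrite !HF // !HG.
Qed.

End representation.

Definition opPstar := diffop (@adj_coef0 R 1 0) (@adj_coef1 R 2).
Definition opRstar := diffop (@adj_coef0 R 2 (- (1 / 2))) (@adj_coef1 R 0).

Lemma jet_free_coef0 a b k j : (k < 4)%N -> (j < 4)%N ->
  jet_free (@adj_coef0 R a b k j).
Proof. by case: k j => [|[|[|[|//]]]] [|[|[|[|//]]]]. Qed.

Lemma jet_free_coef1 a i k j : (i < 3)%N -> (k < 4)%N -> (j < 4)%N ->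
  jet_free (@adj_coef1 R a i k j).
Proof.
by case: i k j => [|[|[|//]]] [|[|[|[|//]]]] [|[|[|[|//]]]].
Qed.

Section adjoint_representation.
Variable u : nat -> X -> R.
Hypothesis su : forall k, smooth (u k).
Variables (F : X -> R4) (e : nat -> expr).
Hypothesis HF : @rep R u 3 F e.

Lemma rep_Pstar :
  @rep R u 3 (diffop1 (@adj_coef0 R 1 0) (@adj_coef1 R 2) F) (fPs e).
Proof.
exact: (rep_diffop1 su (@jet_free_coef0 1 0) (@jet_free_coef1 2) HF).
Qed.

Lemma rep_Rstar :
  @rep R u 3 (diffop1 (@adj_coef0 R 2 (- (1 / 2))) (@adj_coef1 R 0) F) (fRs e).
Proof.
exact: (rep_diffop1 su (@jet_free_coef0 2 (- (1 / 2))) (@jet_free_coef1 0) HF).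
Qed.

End adjoint_representation.

Lemma smooth_entry (F : Cinf R) k j : smooth (entry k j F).
Proof. by have /asboolP := Cinf_smooth F; exact. Qed.

Definition components (F : Cinf R) k : X -> R := entry 0 (inord k) F.

Lemma rep_components F : @rep R (components F) 3 F (@jets R).
Proof. by []. Qed.

Lemma Cinf_eq (F G : Cinf R) : F = G :> (X -> R4) -> F = G.
Proof. by move=> FG; apply: val_inj. Qed.

Lemma golden_adj (lambda : R) :
  golden_transmutation (stokes R) (laplacian4 R)
      (opP R)
      (((1 / 3) \*: opRstar) \+ (lambda \*: opQhat R))
      (opR R)
      (((1 / 3) \*: opPstar) \+ (lambda \*: opShat R))
      (opT R \+ (lambda \*: opThat R)).
Proof.
split=> F; apply: Cinf_eq;
  have su k : smooth (components F k) := smooth_entry F 0 _;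
  have HF := rep_components F.
- have HP := rep_P su HF.
  have HL := rep_laplacian su HF.
  have E := rep_eq (rep_stokes su HP) (rep_R su HL) (@formal_AP_RB R).
  (* By conversion: [lift] keeps the underlying functions. *)
  exact: E.
- have HS := rep_stokes su HF.
  have HQ := rep_lin (1 / 3) lambda (rep_Rstar su HF) (rep_Qhat su HF).
  have HS' := rep_lin (1 / 3) lambda (rep_Pstar su HS) (rep_Shat su HS).
  have E := rep_eq (rep_laplacian su HQ) HS' (formal_BQ_SA _).
  exact: E.
- have HS := rep_stokes su HF.
  have HQ := rep_lin (1 / 3) lambda (rep_Rstar su HF) (rep_Qhat su HF).
  have HT := rep_lin1 lambda (rep_T HS) (rep_That su HS).
  have E := rep_eq (rep_add (rep_P su HQ) HT) HF (formal_PQ_TA _).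
  exact: E.
- have HS := rep_lin (1 / 3) lambda (rep_Pstar su HF) (rep_Shat su HF).
  have HT := rep_lin1 lambda (rep_T HF) (rep_That su HF).
  have E := rep_eq (rep_add (rep_R su HS) (rep_stokes su HT)) HF
    (formal_RS_AT _).
  exact: E.
Qed.

(** * Green's identities in divergence form *)

Section green.
Variables F G : Cinf R.

Definition pair_components k : X -> R :=
  if (k < 4)%N then components F k else components G (k - 4).

Lemma smooth_pair_components k : smooth (pair_components k).
Proof. by rewrite /pair_components; case: ifP => _; exact: smooth_entry. Qed.

Lemma rep_pair1 : @rep R pair_components 3 F (@jets R).
Proof. by move=> k k4; rewrite /interp /= /jet /= /pair_components k4. Qed.

Lemma rep_pair2 : @rep R pair_components 3 G (fun k => @jets R k.+4).
Proof.
move=> k k4; rewrite /interp /= /jet /= /pair_components.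
by have -> : (k.+4 - 4 = k)%N by rewrite -addn4 addnK.
Qed.

Lemma interp_fdiv e x : interp pair_components (fdiv e) x =
  \sum_i partial i (interp pair_components (e i)) x.
Proof.
rewrite sum_ord3 !partial_interp ?inordK //; exact: smooth_pair_components.
Qed.

Lemma green_P x : dot (opP R F x) (G x) = dot (F x) (opPstar G x)
  + \sum_i partial i (interp pair_components (flux (-2) i)) x.
Proof.
have su := smooth_pair_components.
have HP := interp_dot4 (rep_P su rep_pair1) rep_pair2.
have HA := interp_dot4 rep_pair1 (rep_Pstar su rep_pair2).
rewrite -interp_fdiv.
have E1 := congr1 (@^~ x) HP; have E2 := congr1 (@^~ x) HA.
exact: etrans E1 (etrans (formal_green_P _ _) (esym (congr1
  (fun z => z + interp pair_components (fdiv (flux (-2))) x) E2))).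
Qed.

Lemma green_R x : dot (opR R F x) (G x) = dot (F x) (opRstar G x)
  + \sum_i partial i (interp pair_components (flux 0 i)) x.
Proof.
have su := smooth_pair_components.
have HP := interp_dot4 (rep_R su rep_pair1) rep_pair2.
have HA := interp_dot4 rep_pair1 (rep_Rstar su rep_pair2).
rewrite -interp_fdiv.
have E1 := congr1 (@^~ x) HP; have E2 := congr1 (@^~ x) HA.
exact: etrans E1 (etrans (formal_green_R _ _) (esym (congr1
  (fun z => z + interp pair_components (fdiv (flux 0)) x) E2))).
Qed.

(** Every term of the flux has an underived component of [F] as a factor, so its support lies in
    that of [F]. *)
Lemma flux_eq0 c i x : (i < 3)%N -> F x = 0 ->
  interp pair_components (flux c i) x = 0.
Proof.
move=> i3 Fx.
have J0 k : (k < 4)%N -> pair_components k x = 0.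
  by move=> k4; rewrite /pair_components k4 /components /entry Fx mxE.
by case: i i3 => [|[|[|//]]] _; rewrite /interp /= /jet /=
  (J0 0%N isT) (J0 1%N isT) (J0 2%N isT) (J0 3%N isT); ring.
Qed.

End green.

End operators.

(** * Integration over R^3 *)

Section integration.
Variable R : realType.
Local Notation X := 'rV[R]_3.
Local Notation mu := (@lebesgue_measure R).
Local Notation mT := (measurableTypeR R).
Implicit Types f : X -> R.

Definition point3 (t : mT * mT * mT) : X := \row_i [:: t.1.1; t.1.2; t.2]`_i.

Lemma dist_lt_between (a b x y e : R) : x - e < a -> b < x + e -> a < y ->
  y < b -> `|x - y| < e.
Proof. by move=> *; rewrite ltr_norml; apply/andP; split; lra. Qed.

(* Open sets are countable unions of boxes with rational corners, hence
   measurable for the product sigma-algebra. *)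
Lemma measurable_continuous3 f : continuous f ->
  measurable_fun [set: mT * mT * mT] (f \o point3 : _ -> R).
Proof.
move=> cf.
apply: (measurability _ (measurable_realfun.RGenOpens.measurableE R)).
move=> _ [_ [a [b ->]] <-]; rewrite setTI.
pose V := f @^-1` `]a, b[%classic.
have oV : open V.
  by apply: open_comp; [move=> x _; exact: cf|exact: interval_open].
pose box (q : (rat * rat) * (rat * rat) * (rat * rat)) : set (mT * mT * mT) :=
  (`]ratr q.1.1.1, ratr q.1.1.2[%classic
    `*` `]ratr q.1.2.1, ratr q.1.2.2[%classic)
   `*` `]ratr q.2.1, ratr q.2.2[%classic.
(* Boxes not contained in the preimage are replaced by the empty set, so that the union runs over a
   whole countable type. *)
pose inner q := if `[< box q `<=` point3 @^-1` V >] then box q else set0.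
rewrite (_ : _ @^-1` _ = \bigcup_q inner q).
  apply: countable_bigcupT_measurable => [|q]; first exact: countableP.
  rewrite /inner; case: ifP => // _.
  by apply: measurableX; [apply: measurableX|]; exact: measurable_itv.
apply/seteqP; split => t; last first.
  by move=> [q _]; rewrite /inner; case: asboolP => // qV /qV.
move=> Vt; have /nbhs_boxP[e e0 eV] : nbhs (point3 t) V.
  exact: open_nbhs_nbhs.
have rat_near (x : R) : exists p : rat * rat,
    [/\ ratr p.1 < x < ratr p.2, x - e < ratr p.1 & ratr p.2 < x + e].
  have [p1] : exists q, ratr q \in `]x - e, x[ by apply: rat_in_itvoo; lra.
  have [p2] : exists q, ratr q \in `]x, x + e[ by apply: rat_in_itvoo; lra.
  rewrite !in_itv /= => /andP[h1 h2] /andP[h3 h4].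
  by exists (p1, p2); rewrite h1 h4; split.
have [p1 [/andP[p1a p1b] p1c p1d]] := rat_near t.1.1.
have [p2 [/andP[p2a p2b] p2c p2d]] := rat_near t.1.2.
have [p3 [/andP[p3a p3b] p3c p3d]] := rat_near t.2.
exists (p1, p2, p3) => //; rewrite /inner; case: asboolP => [_|[]].
  by rewrite /box /=; repeat split => /=; rewrite in_itv /= ?p1a ?p2a ?p3a.
move=> s [[/=]]; rewrite /= !in_itv /=.
move=> /andP[s1 s1'] /andP[s2 s2'] /andP[s3 s3']; apply: eV => j; rewrite !mxE.
case: j => [[|[|[|//]]] _] /=.
- exact: dist_lt_between p1c p1d s1 s1'.
- exact: dist_lt_between p2c p2d s2 s2'.
- exact: dist_lt_between p3c p3d s3 s3'.
Qed.

(** Quantitative form of compact support; see [compact_supportP]. *)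
Definition box_supported (M : R) f :=
  forall x, f x != 0 -> forall j, `|x 0 j| <= M.

Lemma continuous_box_bounded M f : continuous f -> box_supported M f ->
  exists C : R, forall x, `|f x| <= C.
Proof.
move=> cf sf.
have cK : compact [set x : X | forall i, x ord0 i \in `[- M, M]].
  apply: (@rV_compact _ _ (fun=> `[- M, M]%classic)) => _.
  exact: segment_compact.
have : compact (f @` [set x : X | forall i, x ord0 i \in `[- M, M]]).
  by apply: continuous_compact => //; exact: continuous_subspaceT.
move=> /compact_bounded[C [_ /(_ (`|C| + 1))]] => H.
(* [compact_bounded] gives a bound by every number above [C]; this one is also nonnegative, as
   needed where [f] vanishes. *)
exists (`|C| + 1) => x; have [->|fx] := eqVneq (f x) 0.
  by rewrite normr0 addr_ge0.
apply: H; first by rewrite ltr_pwDr // ler_norm.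
by exists x => // i; rewrite in_itv /= -ler_norml; exact: sf.
Qed.

Lemma bounded_support_integrable d (T : measurableType d)
    (m : {measure set T -> \bar R}) (D : set T) (g : T -> R) (C : R) :
  measurable D -> (m D < +oo)%E -> measurable_fun setT g ->
  (forall t, `|g t| <= C) -> (forall t, g t != 0 -> D t) ->
  m.-integrable setT (EFin \o g).
Proof.
move=> mD finD mg gC gD.
have -> : EFin \o g = (EFin \o g) \_ D.
  apply/funext => t; rewrite patchE; case: ifPn => // /negP tD /=.
  have [->//|/gD Dt] := eqVneq (g t) 0.
  by exfalso; apply: tD; rewrite inE.
apply/(integrable_mkcond _ mD).
apply: measurable_bounded_integrable => //; first exact: measurable_funTS.
exists C; split; first exact: num_real.
by move=> x Cx t _ /=; exact: le_trans (gC t) (ltW Cx).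
Qed.

Lemma mu_itv_fin (M : R) : (mu `[(- M)%R, M]%classic < +oo)%E.
Proof.
by rewrite lebesgue_measure_itv /=; case: ifP => // _; rewrite -EFinD ltry.
Qed.

Lemma mu2_box_fin (M : R) :
  ((mu \x mu) (`[(- M)%R, M] `*` `[(- M)%R, M])%classic < +oo)%E.
Proof.
rewrite product_measure1E; [|exact: measurable_itv..].
by apply: lte_mul_pinfty; rewrite ?ge0_fin_numE ?mu_itv_fin.
Qed.

Lemma integrable3 M f : continuous f -> box_supported M f ->
  (mu \x mu \x mu)%E.-integrable setT (EFin \o (f \o point3)).
Proof.
move=> cf sf; have [C fC] := continuous_box_bounded cf sf.
apply: (@bounded_support_integrable _ (mT * mT * mT)%type (mu \x mu \x mu)%E
  ((`[(- M)%R, M] `*` `[(- M)%R, M]) `*` `[(- M)%R, M])%classic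
  (f \o point3) C) => //.
- by apply: measurableX; [apply: measurableX|]; exact: measurable_itv.
- rewrite /= product_measure1E; last 2 first.
  + by apply: measurableX; exact: measurable_itv.
  + exact: measurable_itv.
  by apply: lte_mul_pinfty; rewrite ?ge0_fin_numE ?mu2_box_fin // mu_itv_fin.
- exact: measurable_continuous3.
- by move=> t; exact: fC.
- move=> t /sf H; repeat split; rewrite /= in_itv /= -ler_norml.
  + by have := H (inord 0); rewrite mxE /= inordK.
  + by have := H (inord 1); rewrite mxE /= inordK.
  + by have := H (inord 2); rewrite mxE /= inordK.
Qed.

(** Slices at a fixed last coordinate, for the second application of Fubini. *)
Lemma integrable2 M f (z : R) : continuous f -> box_supported M f ->
  (mu \x mu)%E.-integrable setT (fun t => (f (point3 (t, z)))%:E).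
Proof.
move=> cf sf; have [C fC] := continuous_box_bounded cf sf.
apply: (@bounded_support_integrable _ (mT * mT)%type (mu \x mu)%E
  (`[(- M)%R, M] `*` `[(- M)%R, M])%classic
  (fun t => f (point3 (t, z))) C) => //.
- by apply: measurableX; exact: measurable_itv.
- exact: mu2_box_fin.
- exact: (measurable_fun_pair1 z (measurable_continuous3 cf)).
- move=> t /sf H; repeat split; rewrite /= in_itv /= -ler_norml.
  + by have := H (inord 0); rewrite mxE /= inordK.
  + by have := H (inord 1); rewrite mxE /= inordK.
Qed.

Lemma integral_derivative (M : R) (g g' : R -> R) : 0 < M ->
  (forall s : R, is_derive s 1 g (g' s)) -> continuous g' ->
  g M = 0 -> g (- M) = 0 -> (forall s, g' s != 0 -> `|s| <= M) ->
  (\int[mu]_s (g' s)%:E = 0)%E.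
Proof.
move=> M0 dg cg' gM gNM sg.
have cg : continuous g.
  move=> s; apply: differentiable_continuous; apply/derivable1_diffP.
  by have [] := dg s.
have -> : (fun s => (g' s)%:E) = (EFin \o g') \_ `[- M, M]%classic.
  apply/funext => t; rewrite patchE; case: ifPn => // /negP tD /=.
  have [->//|/sg Dt] := eqVneq (g' t) 0.
  by exfalso; apply: tD; rewrite inE /= in_itv /= -ler_norml.
rewrite -integral_mkcond /= (@continuous_FTC2 _ g' g (- M) M).
- by rewrite gM gNM sube0.
- by lra.
- exact: continuous_subspaceT.
- split; first by move=> s _; have [] := dg s.
  + by apply: cvg_at_right_filter; exact: cg.
  + by apply: cvg_at_left_filter; exact: cg.
- by move=> s _; rewrite derive1E; have [] := dg s.
Qed.

Lemma partial_near f g i (x : X) : (\forall y \near x, f y = g y) ->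
  partial i f x = partial i g x.
Proof. by move=> fg; apply: near_eq_derive. Qed.

Lemma partial_box_supported M f i : box_supported M f ->
  box_supported M (partial i f).
Proof.
move=> sf x fx j; rewrite leNgt; apply/negP => Mx; move/eqP: fx; apply.
rewrite (@partial_near _ (fun=> 0)) ?partial_cst //.
(* The distance from x to the cube in coordinate [j]: within it [f] vanishes. *)
apply/nbhs_boxP; exists (`|x 0 j| - M); first by rewrite subr_gt0.
move=> y /(_ j) xy; apply/eqP/negPn/negP => /sf /(_ j) yM.
have := ler_distD (y 0 j) (x 0 j) 0; rewrite !subr0 => H.
by have := lt_le_trans xy (lexx _); lra.
Qed.

Lemma box_supportedW M N f : M <= N -> box_supported M f -> box_supported N f.
Proof. by move=> MN sf x fx j; exact: le_trans (sf x fx j) MN. Qed.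

(** [h] is a line in direction ['e_i] parametrized by its [i]-th coordinate; keeping it abstract
    serves all three directions. *)
Lemma integral_line M f i (h : R -> X) :
  smooth f -> box_supported M f -> 0 < M ->
  (forall s, h s = h 0 + s *: 'e_i) -> (forall s, h s 0 i = s) ->
  (\int[mu]_s (partial i f (h s))%:E = 0)%E.
Proof.
move=> sf bf M0 hE hi.
have h_cont : continuous h.
  rewrite (_ : h = fun s => h 0 + s *: 'e_i); last exact/funext.
  move=> s; apply: cvgD; first exact: cvg_cst.
  exact: cvgZr_tmp.
have big_vanish (s : R) : M < `|s| -> f (h s) = 0.
  move=> Ms; apply/eqP/negPn/negP => /bf /(_ i); rewrite hi; lra.
(* [M + 1] lies strictly outside the cube, where [box_supported] makes [f] vanish. *)
apply: (@integral_derivative (M + 1) (f \o h)); first by lra.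
- move=> s; have := smooth_line_derive i (h 0) s sf.
  rewrite -hE; rewrite (_ : (fun t => f (h 0 + t *: 'e_i)) = f \o h) //.
  by apply/funext => t /=; rewrite [in RHS]hE.
- move=> s; apply: continuous_comp; first exact: h_cont.
  exact: smooth_continuous (smooth_partial _ sf) _.
- by apply: big_vanish; rewrite gtr0_norm; lra.
- by apply: big_vanish; rewrite normrN gtr0_norm; lra.
- by move=> s /(partial_box_supported bf)/(_ i); rewrite hi; lra.
Qed.

Lemma ord3_cases (P : 'I_3 -> Prop) :
  P (inord 0) -> P (inord 1) -> P (inord 2) -> forall i, P i.
Proof.
move=> P0 P1 P2 [[|[|[|//]]] Hi].
- by rewrite (_ : Ordinal Hi = inord 0) //; apply/val_inj; rewrite /= inordK.
- by rewrite (_ : Ordinal Hi = inord 1) //; apply/val_inj; rewrite /= inordK.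
- by rewrite (_ : Ordinal Hi = inord 2) //; apply/val_inj; rewrite /= inordK.
Qed.

Lemma sigma_finite_mu2 : sigma_finite setT (mu \x mu)%E.
Proof.
exists (fun n => `[- n%:R, n%:R]%classic `*` `[- n%:R, n%:R]%classic) => [|n].
  apply/esym/seteqP; split => // -[x y] _.
  exists (Num.bound (Num.max `|x| `|y|)) => //.
  have : 0 <= Num.max `|x| `|y| by rewrite le_max normr_ge0.
  move=> /archi_boundP.
  rewrite gt_max => /andP[/ltW xn /ltW yn].
  by split; rewrite /= in_itv /= -ler_norml.
by split; [apply: measurableX; exact: measurable_itv|exact: mu2_box_fin].
Qed.

(* The canonical structure on a product measure in the library is the one of
   (sub)probabilities, whence the explicit packing. *)
Let mu2 : {sigma_finite_measure set (mT * mT)%type -> \bar R} :=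
  HB.pack_for {sigma_finite_measure set (mT * mT)%type -> \bar R} (mu \x mu)%E
    (Measure_isSigmaFinite.Build _ _ _ (mu \x mu)%E sigma_finite_mu2).

(** This order serves the derivatives in directions 0 and 1, [integral_last_in] the one in direction
    2. *)
Lemma integral_last_out (F : mT * mT * mT -> \bar R) :
  (mu \x mu \x mu)%E.-integrable setT F ->
  (\int[mu \x mu \x mu]_t F t = \int[mu]_z \int[mu \x mu]_t F (t, z))%E.
Proof.
move=> iF; exact: esym (@integral21_prod_meas1 _ _ _ _ R mu2 mu F iF).
Qed.

Lemma integral_last_in (F : mT * mT * mT -> \bar R) :
  (mu \x mu \x mu)%E.-integrable setT F ->
  (\int[mu \x mu \x mu]_t F t = \int[mu \x mu]_t \int[mu]_z F (t, z))%E.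
Proof.
move=> iF; exact: esym (@integral12_prod_meas1 _ _ _ _ R mu2 mu F iF).
Qed.

(** Fubini with the variable of differentiation innermost, where [integral_line] applies. *)
Lemma integral_partial M f i : smooth f -> box_supported M f ->
  (\int[mu \x mu \x mu]_t (partial i f (point3 t))%:E = 0)%E.
Proof.
(* [M] may be negative or 0, while [integral_line] asks for a positive bound. *)
move=> sf bf0; pose N := `|M| + 1.
have N0 : 0 < N by rewrite ltr_wpDl.
have bf : box_supported N f.
  by apply: box_supportedW bf0; apply: le_trans (ler_norm _) _; rewrite lerDl.
have spf := smooth_continuous (smooth_partial i sf).
have bpf := @partial_box_supported _ _ i bf.
have i3 := integrable3 spf bpf.
have i2 z := integrable2 z spf bpf.
have coord (t t' : mT * mT * mT) (s : R) k : (k < 3)%N ->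
    (forall l, (l < 3)%N -> [:: t.1.1; t.1.2; t.2]`_l =
       [:: t'.1.1; t'.1.2; t'.2]`_l + s * (l == k)%:R) ->
    point3 t = point3 t' + s *: 'e_(inord k).
  move=> k3 H; apply/rowP => l; rewrite !mxE H //= -val_eqE /= inordK //.
move: i spf bpf i3 i2; apply: ord3_cases => spf bpf i3 i2.
- apply: etrans (integral_last_out i3) _; apply: integral0_eq => z _.
  apply: etrans (esym (integral21_prod_meas1 (i2 z))) _.
  apply: integral0_eq => y _.
  apply: (integral_line (h := fun s => point3 (s, y, z)) sf bf N0).
    by move=> s; apply: coord => // -[|[|[|//]]] _ /=; ring.
  by move=> s; rewrite mxE /= inordK.
- apply: etrans (integral_last_out i3) _; apply: integral0_eq => z _.
  apply: etrans (esym (integral12_prod_meas1 (i2 z))) _.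
  apply: integral0_eq => y _.
  apply: (integral_line (h := fun s => point3 (y, s, z)) sf bf N0).
    by move=> s; apply: coord => // -[|[|[|//]]] _ /=; ring.
  by move=> s; rewrite mxE /= inordK.
- apply: etrans (integral_last_in i3) _; apply: integral0_eq => -[x y] _.
  apply: (integral_line (h := fun s => point3 (x, y, s)) sf bf N0).
    by move=> s; apply: coord => // -[|[|[|//]]] _ /=; ring.
  by move=> s; rewrite mxE /= inordK.
Qed.

Lemma integral3E f :
  integral3 f = fine (\int[mu \x mu \x mu]_t (f (point3 t))%:E)%E.
Proof. by []. Qed.

(** If f(x0) > 0, then f > f(x0)/2 on a cube of side e around x0, so the integral is at least e^3
    f(x0)/2 > 0. *)
Lemma integral3_eq0 M f :
  continuous f -> (forall x, 0 <= f x) -> box_supported M f ->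
  integral3 f = 0 -> forall x, f x = 0.
Proof.
move=> cf f0 bf if0 x0; apply/eqP/negPn/negP => fx0.
have c0 : 0 < f x0 by rewrite lt_neqAle f0 eq_sym fx0.
have int := integrable3 cf bf.
(* [fine] also sends infinity to 0, so integrability is used here. *)
have I0 : (\int[mu \x mu \x mu]_t (f (point3 t))%:E = 0)%E.
  by rewrite -[LHS]fineK ?(integrable_fin_num _ int) // -integral3E if0.
have : nbhs x0 [set y | f x0 / 2 < f y].
  have /cvgrPdist_lt /(_ (f x0 / 2)) := cf x0.
  have h2 : 0 < f x0 / 2 by rewrite divr_gt0.
  move=> /(_ h2); apply: filterS => y /=; rewrite ltr_norml => /andP[_]; lra.
move=> /nbhs_boxP[e e0 eP].
pose J k := `[x0 0 (inord k) - e / 2, x0 0 (inord k) + e / 2]%classic : set mT.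
pose D : set (mT * mT * mT) := (J 0%N `*` J 1%N) `*` J 2%N.
have mJ k : measurable (J k) by exact: measurable_itv.
have mJE k : mu (J k) = e%:E.
  rewrite /J lebesgue_measure_itv /= lte_fin ifT; last by lra.
  by rewrite /= -EFinB (_ : _ - _ = e) //; by field.
have mJ2 : measurable (J 0%N `*` J 1%N) by apply: measurableX; exact: mJ.
have mD : measurable D by apply: measurableX; [exact: mJ2|exact: mJ].
have mDE : (mu \x mu \x mu)%E D = (e * e * e)%:E.
  have E2 : (mu \x mu)%E (J 0%N `*` J 1%N) = (e * e)%:E.
    exact: etrans (product_measure1E _ _ (mJ _) (mJ _))
      (congr2 mule (mJE _) (mJE _)).
  exact: etrans (product_measure1E _ _ mJ2 (mJ _)) (congr2 mule E2 (mJE _)).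
have : ((f x0 / 2 * (e * e * e))%:E <=
    \int[mu \x mu \x mu]_t (f (point3 t))%:E)%E.
  rewrite EFinM -mDE -integral_cst //.
  have mf := measurable_int _ int.
  apply: (@le_trans _ _ (\int[mu \x mu \x mu]_(t in D) (f (point3 t))%:E)%E).
    apply: ge0_le_integral => //.
    - by move=> t _; rewrite lee_fin; lra.
    - exact: (measurable_funS measurableT (@subsetT _ D) mf).
    - move=> t [[D1 D2] D3]; rewrite lee_fin; apply/ltW/eP.
      have close k (y : R) : J k y -> `|x0 0 (inord k) - y| < e.
        rewrite /J /= in_itv /= => /andP[? ?].
        by rewrite ltr_norml; apply/andP; split; lra.
      by apply: ord3_cases; rewrite mxE /= inordK //=; exact: close.
  apply: ge0_subset_integral => //.
  by move=> t _; rewrite lee_fin.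
by rewrite I0 lee_fin leNgt mulr_gt0 ?divr_gt0 ?mulr_gt0.
Qed.

End integration.

(** * Cutoff functions *)

Section cutoff.
Variable R : realType.
Local Notation X := 'rV[R]_3.

(** The classical e^(-1/t) times t^-n, extended by 0. With the powers included, derivatives are
    linear combinations of members of the family. *)
Definition flat (n : nat) (t : R) : R :=
  if 0 < t then t^-1 ^+ n * expR (- t^-1) else 0.

Lemma flat_le0 n (t : R) : t <= 0 -> flat n t = 0.
Proof. by rewrite /flat leNgt => /negbTE ->. Qed.

(** With y = 1/t this is e^y >= y^(n+2) / (n+2)!. The square on the right makes the difference
    quotient at 0 tend to 0. *)
Lemma flat_bound n (t : R) : `|flat n t| <= n.+2`!%:R * t ^+ 2.
Proof.
rewrite /flat; case: ifP => [t0|_]; last first.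
  by rewrite normr0 mulr_ge0 // exprn_even_ge0.
have y0 : 0 < t^-1 by rewrite invr_gt0.
have -> : t ^+ 2 = (t^-1 ^+ 2)^-1 by rewrite exprVn invrK.
move: (t^-1) y0 => y y0.
have ge0 : 0 <= y ^+ n * expR (- y).
  by rewrite mulr_ge0 ?expR_ge0 ?exprn_ge0 ?(ltW y0).
rewrite ger0_norm {ge0}//.
rewrite expRN ler_pdivrMr ?expR_gt0 //.
have := @expR_ge1Dxn R y n.+1 (ltW y0) => H.
have f0 : 0 < n.+2`!%:R :> R by rewrite ltr0n fact_gt0.
have {}H : y ^+ n.+2 <= n.+2`!%:R * expR y.
  rewrite mulrC -ler_pdivrMr //; apply: le_trans H; rewrite lerDr ler01//.
rewrite mulrAC ler_pdivlMr ?exprn_gt0 // -exprD addn2 //.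
Qed.

Lemma is_derive_flat n (t : R) :
  is_derive t 1 (flat n) (flat n.+2 t - n%:R * flat n.+1 t).
Proof.
have [t0|t0|t0] := ltgtP t 0.
- rewrite !flat_le0 ?(ltW t0) // mulr0 subr0.
  apply: (@near_eq_is_derive _ _ _ (fun=> 0)) => //.
  by apply: filterS (lt_nbhsl t0) => s /ltW s0; rewrite flat_le0.
- apply: (@near_eq_is_derive R R^o R^o
    (fun s : R => s^-1 ^+ n * expR (- s^-1))).
    by apply: filterS (lt_nbhsr t0) => s s0; rewrite /flat s0.
  rewrite /flat t0.
  (* Chain rule through y = 1/s. *)
  have dg (y : R) : is_derive y 1 (fun y => y ^+ n * expR (- y))
      (n%:R * y ^+ n.-1 * expR (- y) - y ^+ n * expR (- y)).
    have dX : is_derive y 1 (fun y : R => y ^+ n) (n%:R * y ^+ n.-1).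
      have := @is_deriveX R R^o id n y 1 1 (is_derive_id _ _).
      by rewrite [_ *: _]mulr1 exprfctE.
    have dE : is_derive y 1 (fun y : R => expR (- y)) (expR (- y) * -1).
      by apply: (@is_derive1_comp _ expR -%R); exact: is_deriveN.
    have dM : is_derive y 1 (fun y : R => y ^+ n * expR (- y)) _ :=
      @is_deriveM R R^o _ _ y 1 _ _ dX dE.
    by apply: (is_derive_eq dM); rewrite /GRing.scale /=; ring.
  have dV : is_derive t 1 (fun s : R => s^-1) (- t ^- 2).
    have := @is_deriveV R id t 1 1 (lt0r_neq0 t0) (is_derive_id _ _).
    by rewrite [_ *: _]mulr1.
  have dC : is_derive t 1 (fun s : R => s^-1 ^+ n * expR (- s^-1)) _ :=
    @is_derive1_comp _ _ _ t _ _ (dg t^-1) dV.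
  apply: (is_derive_eq dC); rewrite -exprVn.
  (* [n.-1] is truncated at 0, so n = 0 is separate. *)
  case: n {dg dC} => [|n]; first by rewrite /=; ring.
  by rewrite /= !exprS; ring.
- rewrite t0 !flat_le0 // mulr0 subr0.
  (* By [flat_bound] the quotient is at most (n+2)! |h|. *)
  have dq : (fun h : R => h^-1 *: (flat n (h *: 1 + 0) - flat n 0)) @ 0^'
      --> (0 : R).
    apply/cvgrPdist_lt => e e0; near=> h.
    have h0 : h != 0 by near: h; exact: nbhs_dnbhs_neq.
    rewrite sub0r normrN [h *: 1]mulr1 addr0 (flat_le0 n (lexx 0)) subr0.
    rewrite normrZ normfV ltr_pdivrMl ?normr_gt0 //.
    apply: le_lt_trans (flat_bound n h) _.
    rewrite -(real_normK (num_real h)) expr2 mulrCA ltr_pM2l ?normr_gt0 //.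
    have f0 : 0 < n.+2`!%:R :> R by rewrite ltr0n fact_gt0.
    rewrite mulrC -ltr_pdivlMr //; near: h; apply: dnbhs0_lt.
    exact: divr_gt0.
  by split; [apply/cvg_ex; exists 0|apply/cvg_lim].
Unshelve. all: by end_near.
Qed.

Lemma is_derive_along (f : X -> R) (x v : X) (d : R) :
  is_derive (0 : R) 1 (fun t : R => f (x + t *: v)) d -> is_derive x v f d.
Proof.
have E : (fun h : R =>
      h^-1 *: (f (x + (h *: (1 : R) + 0) *: v) - f (x + 0 *: v))) =
    (fun h : R => h^-1 *: (f (h *: v + x) - f x)).
  apply/funext => h; congr (_ *: (f _ - f _)).
    by rewrite addr0 [h *: 1]mulr1 addrC.
  by rewrite scale0r addr0.
by move=> [df dE]; split; [rewrite /derivable /= -E|rewrite /derive /= -E].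
Qed.

Lemma is_derive_flat_comp n (g : X -> R) i x : smooth g ->
  is_derive x 'e_i (fun y => flat n (g y))
    ((flat n.+2 (g x) + - n%:R * flat n.+1 (g x)) * partial i g x).
Proof.
move=> sg; apply: is_derive_along.
have := smooth_line_derive i x 0 sg; rewrite scale0r addr0 => dg.
rewrite mulNr.
apply: (@is_derive1_comp _ (flat n) (fun t : R => g (x + t *: 'e_i)) 0) => //.
by rewrite scale0r addr0; exact: is_derive_flat.
Qed.

(** Induction on [k] for all [n] at once, since differentiating raises [n]. *)
Lemma smooth_flat_comp n (g : X -> R) : smooth g ->
  smooth (fun y => flat n (g y)).
Proof.
move=> sg k; elim: k n => [|k IH] n.
  move=> x; apply: continuous_comp; first exact: smooth_continuous.
  apply: differentiable_continuous; apply/derivable1_diffP.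
  by have [] := is_derive_flat n (g x).
split.
- exact: Ck_continuous (IH n).
- by move=> i x; have [] := is_derive_flat_comp n i x sg.
- move=> i; rewrite (_ : partial i _ = fun x =>
      (flat n.+2 (g x) + - n%:R * flat n.+1 (g x)) * partial i g x).
    apply: CkM; last exact: smooth_partial.
    by apply: CkD => //; apply: CkM => //; exact: Ck_cst.
  by apply/funext => x; have [_ <-] := is_derive_flat_comp n i x sg.
Qed.

Lemma flat0_gt0 (t : R) : 0 < t -> 0 < flat 0 t.
Proof. by move=> t0; rewrite /flat t0 expr0 mul1r expR_gt0. Qed.

Lemma flat0_ge1 (t : R) : 1 <= t -> flat 0 1 <= flat 0 t.
Proof.
move=> t1; have t0 : 0 < t by exact: lt_le_trans t1.
by rewrite /flat t0 ltr01 !expr0 !mul1r ler_expR lerN2 lef_pV2 ?posrE.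
Qed.

(* [flat 0 (c - flat 0 s)] with [c = flat 0 1] is a positive constant for
   [s <= 0] and vanishes for [1 <= s]. *)
Lemma cutoff_exists (x : X) : exists chi : X -> R, exists M : R,
  [/\ smooth chi, box_supported M chi & \forall y \near x, chi y = 1].
Proof.
(* That is |y - x|^2 - 1: at most 3/4 - 1 when all coordinates are within 1/2 of x, at least 4 - 1
   when one is 2 away. *)
pose s (y : X) := \sum_j (y 0 j + - x 0 j) * (y 0 j + - x 0 j) + - 1.
have ss : smooth s.
  apply: smoothD; last exact: smooth_cst.
  apply: smooth_sum => j.
  by apply: smoothM; apply: smoothD; (exact: smooth_coord || exact: smooth_cst).
pose c := flat 0 1; have c0 : 0 < c by exact: flat0_gt0.
exists (fun y => (flat 0 c)^-1 * flat 0 (c + - flat 0 (s y))).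
(* If a coordinate of y exceeds this bound in absolute value, it is at least 2 away from that of
   x. *)
exists (`|x 0 (inord 0)| + `|x 0 (inord 1)| + `|x 0 (inord 2)| + 2); split.
- apply: smoothM; first exact: smooth_cst.
  apply: smooth_flat_comp; apply: smoothD; first exact: smooth_cst.
  by apply: smoothN; exact: smooth_flat_comp.
- move=> y chiy j; rewrite leNgt; apply/negP => yM; move/eqP: chiy; apply.
  rewrite (@flat_le0 _ (c + - _)) ?mulr0 // subr_le0; apply: flat0_ge1.
  have far : 2 <= `|y 0 j - x 0 j|.
    have : `|x 0 j| + 2 <= `|y 0 j|.
      apply: le_trans (ltW yM); rewrite lerD2r.
      have h0 := normr_ge0 (x 0 (inord 0)).
      have h1 := normr_ge0 (x 0 (inord 1)).
      have h2 := normr_ge0 (x 0 (inord 2)).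
      by move: j {yM}; apply: ord3_cases; lra.
    have := ler_normB (y 0 j) (x 0 j); have := lerB_dist (y 0 j) (x 0 j); lra.
  have sq : 4 <= (y 0 j - x 0 j) * (y 0 j - x 0 j).
    rewrite -expr2 -(real_normK (num_real _)) expr2.
    by move: far; set z := `|_| => far; nra.
  rewrite /s (bigD1 j) //=.
  have : 0 <= \sum_(i < 3 | i != j) (y 0 i - x 0 i) * (y 0 i - x 0 i).
    by apply: sumr_ge0 => i _; rewrite -expr2 sqr_ge0.
  move: sq; set z := _ * _; set w := \sum_(_ < _ | _) _; lra.
- apply/nbhs_boxP; exists (1 / 2) => // y xy.
  rewrite (@flat_le0 _ (s y)) ?subr0 ?mulVf // ?gt_eqF ?flat0_gt0 //.
  have sq j : (y 0 j - x 0 j) * (y 0 j - x 0 j) <= 1 / 4.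
    rewrite -expr2 -(real_normK (num_real _)) expr2 distrC.
    by have := xy j; have := normr_ge0 (x 0 j - y 0 j); set z := `|_|; nra.
  rewrite /s sum_ord3; have := sq (inord 0); have := sq (inord 1).
  by have := sq (inord 2); lra.
Qed.

End cutoff.

(** * Uniqueness of formal adjoints *)

Section adjoints.
Variable R : realType.
Local Notation X := 'rV[R]_3.
Local Notation R4 := 'rV[R]_(3 + 1).
Local Notation Cinf := (Cinf R).

Lemma smooth_Cinf (u : Cinf) : smooth_mx u.
Proof. by have /asboolP := Cinf_smooth u. Qed.

Lemma mpartial_near n (a : {ffun 'I_3 -> 'I_n}) (f g : X -> R) x :
  (\forall y \near x, f y = g y) -> mpartial a f x = mpartial a g x.
Proof.
have near_partial i (h k : X -> R) : (\forall y \near x, h y = k y) ->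
    \forall y \near x, partial i h y = partial i k y.
  (* Equality near x holds near every point close to x, so it survives each differentiation. *)
  by move=> /near_join; apply: filterS => y hk; exact: partial_near.
have near_iter m i (h k : X -> R) : (\forall y \near x, h y = k y) ->
    \forall y \near x, iter m (partial i) h y = iter m (partial i) k y.
  by move=> hk; elim: m => //= m IH; exact: near_partial.
move=> fg.
apply: (@nbhs_singleton _ x (fun y => mpartial a f y = mpartial a g y)).
by rewrite /mpartial; elim: (enum 'I_3) => //= i s IH; exact: near_iter.
Qed.

Lemma differential_operator_near (A : Cinf -> Cinf) (u v : Cinf) x :
  differential_operator A -> (\forall y \near x, u y = v y) -> A u x = A v x.
Proof.
move=> [n [c [_ AE]]] uv; rewrite !AE; apply: eq_bigr => a _; congr (_ *m _).
apply/rowP => j; rewrite !mxE; apply: mpartial_near.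
by apply: filterS uv => y uvy; rewrite /entry uvy.
Qed.

Definition supported_in (M : R) (u : Cinf) :=
  forall x, u x != 0 -> forall j, `|x 0 j| <= M.

Lemma supported_near0 M u (x : X) j : supported_in M u -> M < `|x 0 j| ->
  \forall y \near x, u y = 0.
Proof.
move=> su Mx; apply/nbhs_boxP; exists (`|x 0 j| - M); first by rewrite subr_gt0.
move=> y /(_ j) xy; apply/eqP/negPn/negP => /su /(_ j) yM.
by have := ler_distD (y 0 j) (x 0 j) 0; rewrite !subr0; lra.
Qed.

Lemma compact_supportP u : compactly_supported u <-> exists M, supported_in M u.
Proof.
split=> [/compact_bounded[C [_ /(_ (`|C| + 1))]] H|[M su]].
  exists (`|C| + 1) => x ux j.
  have : `|x| <= `|C| + 1.
    by apply: H; [rewrite ltr_pwDr // ler_norm|exact: subset_closure].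
  (* The norm of a row vector is the maximum of its coordinates. *)
  apply: le_trans; rewrite -[leRHS]/(mx_norm x) mx_normrE.
  by apply/bigmax_geP; right => /=; exists (0, j).
pose K := [set x : X | forall i, x ord0 i \in `[- M, M]].
have cK : compact K.
  apply: (@rV_compact _ _ (fun=> `[- M, M]%classic)) => _.
  exact: segment_compact.
apply: subclosed_compact (@closed_closure _ _) cK _.
move=> x Sx i; rewrite in_itv /= -ler_norml leNgt; apply/negP => Mx.
by have [y [/= /eqP uy0 uy]] := Sx _ (supported_near0 su Mx).
Qed.

(** Near a point outside the cube [u] coincides with 0, so locality gives A u = A 0 = 0 there. *)
Lemma differential_operator_supported M (A : {linear Cinf -> Cinf}) u :
  differential_operator A -> supported_in M u -> supported_in M (A u).
Proof.
move=> dA su x Aux j; rewrite leNgt; apply/negP => Mx; move/eqP: Aux; apply.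
rewrite (@differential_operator_near A u 0) //; first by rewrite linear0.
exact: supported_near0 su Mx.
Qed.

Lemma integrable_dot M (u v : Cinf) : supported_in M u ->
  (lebesgue_measure \x lebesgue_measure \x lebesgue_measure)%E.-integrable setT
   (EFin \o ((fun x => dot (u x) (v x)) \o @point3 R)).
Proof.
move=> su; apply: (@integrable3 _ M).
  by apply: smooth_continuous; apply: smooth_dot; exact: smooth_Cinf.
move=> x uvx; apply: su; apply: contraNneq uvx => ->.
by rewrite /dot big1 // => i _; rewrite mxE mul0r.
Qed.

Lemma L2_pairingBr M (u v w : Cinf) : supported_in M u ->
  L2_pairing u (v - w) = L2_pairing u v - L2_pairing u w.
Proof.
move=> su; rewrite /L2_pairing /integral3.
rewrite -RintegralB //; [|exact: integrable_dot su|exact: integrable_dot su].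
apply: eq_Rintegral => t _; rewrite /dot -sumrB; apply: eq_bigr => i _.
by rewrite -mulrBr; congr (_ * _); rewrite /= !mxE.
Qed.

Lemma L2_pairing_eq0 M (u : Cinf) : supported_in M u ->
  L2_pairing u u = 0 -> u = 0.
Proof.
move=> su uu0; apply: Cinf_eq; apply/funext => x.
have H : dot (u x) (u x) = 0.
  apply: (@integral3_eq0 _ M (fun x => dot (u x) (u x))) => //.
  - by apply: smooth_continuous; apply: smooth_dot; exact: smooth_Cinf.
  - by move=> y; apply: sumr_ge0 => i _; rewrite -expr2 sqr_ge0.
  - move=> y uvx; apply: su; apply: contraNneq uvx => ->.
    by rewrite /dot big1 // => i _; rewrite mxE mul0r.
apply/rowP => i; move/eqP: H; rewrite /dot psumr_eq0; last first.
  by move=> j _; rewrite -expr2 sqr_ge0.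
move=> /allP /(_ i (mem_index_enum _)); rewrite /= mulf_eq0 orbb => /eqP ->.
by rewrite mxE.
Qed.

Lemma localize (u : Cinf) (x : X) : exists M, exists v : Cinf,
  supported_in M v /\ \forall y \near x, v y = u y.
Proof.
have [chi [M [schi bchi chi1]]] := cutoff_exists x.
have sv := smooth_mxZ schi (smooth_Cinf u).
exists M, (MkCinf (asboolT sv)); split.
  move=> y /=; have [->|chiy _] := eqVneq (chi y) 0.
    by rewrite scale0r eqxx.
  exact: bchi.
by apply: filterS chi1 => y /= ->; rewrite scale1r.
Qed.

(* If B and C are adjoint to A and v has compact support, then w = (B - C) v has
   compact support and <w, w> = <A w, v> - <A w, v> = 0, so w = 0. The general
   case follows by a cutoff, as B and C are local. *)
Lemma formal_adjoint_unique (A B C : {linear Cinf -> Cinf}) :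
  formal_adjoint A B -> formal_adjoint A C -> B =1 C.
Proof.
move=> [dB AB] [dC AC] u; apply: Cinf_eq; apply/funext => x.
have [M [v [sv vu]]] := localize u x.
have uv : \forall y \near x, u y = v y by apply: filterS vu => y ->.
rewrite (differential_operator_near dB uv) (differential_operator_near dC uv).
suff : B v - C v = 0 by move=> /eqP; rewrite subr_eq0 => /eqP ->.
have sw : supported_in M (B v - C v).
  move=> y Dy j; have [By|By] := eqVneq (B v y) 0; last first.
    exact: differential_operator_supported dB sv y By j.
  apply: (differential_operator_supported dC sv); apply: contraNneq Dy => Cy.
  by rewrite (_ : (B v - C v) y = B v y - C v y) // By Cy subr0.
apply: (L2_pairing_eq0 sw); rewrite (L2_pairingBr _ _ sw).
have cv : compactly_supported v by apply/compact_supportP; exists M.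
have cw : compactly_supported (B v - C v) by apply/compact_supportP; exists M.
by rewrite -AB // -AC // subrr.
Qed.

(** * Existence of the adjoints by integrating divergences *)

Lemma box_supportedD M (f g : X -> R) :
  box_supported M f -> box_supported M g ->
  box_supported M (fun x => f x + g x).
Proof.
move=> bf bg x; have [fx|/bf //] := eqVneq (f x) 0.
by rewrite fx add0r; exact: bg.
Qed.

Lemma integral3D M (f g : X -> R) : continuous f -> continuous g ->
  box_supported M f -> box_supported M g ->
  integral3 (fun x => f x + g x) = integral3 f + integral3 g.
Proof.
move=> cf cg bf bg; rewrite /integral3 RintegralD //.
- exact: integrable3 cf bf.
- exact: integrable3 cg bg.
Qed.

Lemma integral3D_divergence M (f g : X -> R) (F : 'I_3 -> X -> R) :
  continuous g -> box_supported M g ->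
  (forall i, smooth (F i)) -> (forall i, box_supported M (F i)) ->
  (forall x, f x = g x + \sum_i partial i (F i) x) -> integral3 f = integral3 g.
Proof.
move=> cg bg sF bF fE; pose p i := partial i (F i).
have cp i : continuous (p i) := smooth_continuous (smooth_partial i (sF i)).
have bp i : box_supported M (p i) := partial_box_supported (i := i) (bF i).
have p0 i : integral3 (p i) = 0.
  by rewrite integral3E (integral_partial i (sF i) (bF i)).
have -> : f = fun x => g x + (p (inord 0) x + (p (inord 1) x + p (inord 2) x)).
  by apply/funext => x; rewrite fE sum_ord3 !addrA.
have c12 : continuous (fun x => p (inord 1) x + p (inord 2) x).
  (* [Ck 0] is continuity. *)
  exact: (@CkD _ 0).
have b12 := box_supportedD (bp (inord 1)) (bp (inord 2)).
have c012 : continuous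
    (fun x => p (inord 0) x + (p (inord 1) x + p (inord 2) x)).
  exact: (@CkD _ 0).
have b012 := box_supportedD (bp (inord 0)) b12.
rewrite (integral3D cg c012 bg b012) (integral3D (cp _) c12 (bp _) b12).
by rewrite (integral3D (cp _) (cp _) (bp _) (bp _)) !p0 !addr0.
Qed.

(** By [flux_eq0] the flux inherits the compact support of the first argument, so its divergence
    integrates to 0. *)
Lemma green_adjoint (A : {linear Cinf -> Cinf}) c0 c (d : R) :
  (forall (F G : Cinf) x, dot (A F x) (G x) = dot (F x) (diffop c0 c G x)
     + \sum_i partial i (interp (pair_components F G) (flux d i)) x) ->
  formal_adjoint A (diffop c0 c).
Proof.
move=> green; split; first exact: diffop_differential.
move=> u v /compact_supportP[M su] _.
apply: (integral3D_divergence (M := M) (F := fun i : 'I_3 =>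
  interp (pair_components u v) (flux d i))).
- by apply: smooth_continuous; apply: smooth_dot; exact: smooth_Cinf.
- move=> x uvx; apply: su; apply: contraNneq uvx => ->.
  by rewrite /dot big1 // => i _; rewrite mxE mul0r.
- by move=> i; apply: smooth_interp => k; exact: smooth_pair_components.
- by move=> i x Fx; apply: su; apply: contraNneq Fx => ux; apply/eqP/flux_eq0.
- by move=> x; exact: green.
Qed.

End adjoints.

Theorem theorem5p1 (R : realType) (lambda : R) :
  (exists Ps : {linear Cinf R -> Cinf R}, formal_adjoint (opP R) Ps) /\
  (exists Rs : {linear Cinf R -> Cinf R}, formal_adjoint (opR R) Rs) /\
  forall Ps Rs : {linear Cinf R -> Cinf R},
    formal_adjoint (opP R) Ps -> formal_adjoint (opR R) Rs ->
    golden_transmutation (stokes R) (laplacian4 R)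
      (opP R)
      (((1 / 3) \*: Rs) \+ (lambda \*: opQhat R))
      (opR R)
      (((1 / 3) \*: Ps) \+ (lambda \*: opShat R))
      (opT R \+ (lambda \*: opThat R)).
Proof.
have aP : formal_adjoint (opP R) (opPstar R) := green_adjoint (@green_P R).
have aR : formal_adjoint (opR R) (opRstar R) := green_adjoint (@green_R R).
(* Existence keeps the quantification over all adjoints from being vacuous. *)
split; first by exists (opPstar R).
split; first by exists (opRstar R).
(* By uniqueness any [Ps] and [Rs] agree pointwise with the explicit operators, and [golden_adj]
   transfers. *)
move=> Ps Rs /formal_adjoint_unique/(_ aP) PE.
move=> /formal_adjoint_unique/(_ aR) RE.
have [g1 g2 g3 g4] := golden_adj lambda.
split=> // u.
- by have := g2 u; rewrite /= PE RE.
- by have := g3 u; rewrite /= RE.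
- by have := g4 u; rewrite /= PE.
Qed.
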